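(* Let $\sigma>0$, let $j\in\mathbb N=\{0,1,2,\dots\}$, let $\alpha\in\mathbb N^3$ be a multi-index with $\partial_x^\alpha=\partial_{x_1}^{\alpha_1}\partial_{x_2}^{\alpha_2}\partial_{x_3}^{\alpha_3}$, and let $s>2j+|\alpha|-\frac12$. Let $f\in L^1(\mathbb R^3)\cap H^s(\mathbb R^3)$ and let $U(x,t)$ be the solution of $$\partial_t^2U+\Delta^2U+\sigma\partial_tU=0\ \text{ in }\mathbb R^3\times(0,+\infty),\qquad U(x,0)=0,\quad \partial_tU(x,0)=f(x),\quad x\in\mathbb R^3.$$ Then $U$ satisfies the decay estimate $$\sup_{x\in\mathbb R^3}|\partial_x^\alpha\partial_t^jU(x,t)|\lesssim(1+t)^{-\frac{3+|\alpha|}{4}}\|f\|_{L^1(\mathbb R^3)}+e^{-ct}\|f\|_{H^s(\mathbb R^3)},$$ where $c>0$ is some positive constant. In particular, for $j=|\alpha|=s=0$, $$\sup_{x\in\mathbb R^3}|U(x,t)|\lesssim(1+t)^{-\frac34}\big(\|f\|_{L^1(\mathbb R^3)}+\|f\|_{L^2(\mathbb R^3)}\big).$$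
   Context: The solution is the one given by the spatial Fourier transform: $U(x,t)=\mathcal F^{-1}(m_\sigma(t,\xi)\hat f(\xi))(x)=\int_{\mathbb R^3}e^{\mathrm ix\cdot\xi}m_\sigma(t,\xi)\hat f(\xi)\,\mathrm d\xi$, where $\hat f(\xi)=\frac1{(2\pi)^3}\int_{\mathbb R^3}e^{-\mathrm ix\cdot\xi}f(x)\,\mathrm dx$ and $$m_\sigma(t,\xi)=\frac{e^{-\frac\sigma2t}}{\sqrt{\sigma^2-4|\xi|^4}}\Big(e^{\frac12t\sqrt{\sigma^2-4|\xi|^4}}-e^{-\frac12t\sqrt{\sigma^2-4|\xi|^4}}\Big),$$ with $\sqrt{\sigma^2-4|\xi|^4}=\mathrm i\sqrt{4|\xi|^4-\sigma^2}$ when $|\xi|^4>\sigma^2/4$ (and the value at $|\xi|^4=\sigma^2/4$ understood as a limit). The estimates are for all $t\ge 0$. The notation $a\lesssim b$ means $a\le Cb$ with a generic constant $C>0$ independent of $t$ and $f$ (it may depend on $\sigma,\alpha,j,s$, and likewise $c$ is independent of $t$ and $f$). *)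

(* Defs.v *)
From HB Require Import structures.
From mathcomp Require Import all_boot all_order all_algebra.
From mathcomp Require Import complex.
From mathcomp Require Import all_classical all_reals all_analysis.
Import Order.TTheory GRing.Theory Num.Theory.
Import numFieldNormedType.Exports.
Set Implicit Arguments.
Unset Strict Implicit.
Unset Printing Implicit Defensive.
Local Open Scope classical_set_scope.
Local Open Scope ring_scope.

Notation R3 R := (R * R * R)%type.

(** Integration is with respect to the Borel sigma-algebra; every class of
    Lebesgue measurable functions has a Borel representative. *)
Notation leb3 R :=
  ((@lebesgue_measure R \x @lebesgue_measure R) \x @lebesgue_measure R)%E.

Definition cexp (R : realType) (z : R[i]) : R[i] :=
  Complex (expR (complex.Re z) * cos (complex.Im z))
          (expR (complex.Re z) * sin (complex.Im z)).

Definition Cintegral (R : realType) (g : R3 R -> R[i]) : R[i] :=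
  Complex (\int[leb3 R]_x complex.Re (g x)) (\int[leb3 R]_x complex.Im (g x)).

Definition dotR3 (R : realType) (x y : R3 R) : R :=
  x.1.1 * y.1.1 + x.1.2 * y.1.2 + x.2 * y.2.

Definition fourier (R : realType) (f : R3 R -> R[i]) (xi : R3 R) : R[i] :=
  (((2 * pi) ^- 3)%:C)%C *
  Cintegral (fun x => cexp (- ('i * (dotR3 x xi)%:C))%C * f x).

Definition inv_fourier (R : realType) (g : R3 R -> R[i]) (x : R3 R) : R[i] :=
  Cintegral (fun xi => cexp ('i * (dotR3 x xi)%:C)%C * g xi).

(** The branch with sqrt a = i sqrt (- a) for a < 0. *)
Definition csqrt (R : realType) (a : R) : R[i] :=
  if 0 <= a then ((Num.sqrt a)%:C)%C else ('i * (Num.sqrt (- a))%:C)%C.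

(** As a function of t this solves m'' + sigma m' + |xi|^4 m = 0 with m = 0 and
    m' = 1 at t = 0.  On the sphere where the two characteristic roots coincide
    the quotient is replaced by its limit, t e^(- sigma t / 2). *)
Definition multiplier (R : realType) (sigma t : R) (xi : R3 R) : R[i] :=
  let a := sigma ^+ 2 - 4 * dotR3 xi xi ^+ 2 in
  let w := csqrt a in
  if a == 0 then ((t * expR (- (sigma / 2 * t)))%:C)%C
  else ((expR (- (sigma / 2 * t)))%:C)%C / w *
       (cexp ((t / 2)%:C%C * w) - cexp (- ((t / 2)%:C%C * w))).

Definition solution (R : realType) (sigma : R) (f : R3 R -> R[i])
    (x : R3 R) (t : R) : R[i] :=
  inv_fourier (fun xi => multiplier sigma t xi * fourier f xi) x.

Definition cmeasurable (R : realType) (f : R3 R -> R[i]) : Prop :=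
  measurable_fun setT (fun x => complex.Re (f x)) /\
  measurable_fun setT (fun x => complex.Im (f x)).

Definition normLp (R : realType) (p : R) (f : R3 R -> R[i]) : \bar R :=
  Lnorm (leb3 R) p%:E (fun x => (ComplexField.Normc.normc (f x))%:E).

Definition inLp (R : realType) (p : R) (f : R3 R -> R[i]) : Prop :=
  cmeasurable f /\ (normLp p f < +oo)%E.

(** The Bessel potential norm, for any real s.  It is only used for f in L^1,
    where the distributional Fourier transform of f is the function
    [fourier f]. *)
Definition normHs (R : realType) (s : R) (f : R3 R -> R[i]) : \bar R :=
  normLp 2 (fun xi => (((1 + dotR3 xi xi) `^ (s / 2))%:C)%C * fourier f xi).

Definition inL1Hs (R : realType) (s : R) (f : R3 R -> R[i]) : Prop :=
  inLp 1 f /\ (normHs s f < +oo)%E.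

(** Below, W is determined by V at the times t >= 0, which are the only ones
    considered. *)
Definition is_dx (R : realType) (e : R3 R) (V W : R3 R -> R -> R[i]) : Prop :=
  forall x t, 0 <= t ->
    is_derive x e (fun y => complex.Re (V y t) : R) (complex.Re (W x t)) /\
    is_derive x e (fun y => complex.Im (V y t) : R) (complex.Im (W x t)).

(** The derivative of the restriction of v to [0, +oo[: two-sided for t > 0,
    right derivative at t = 0. *)
Definition is_derive_ge0 (R : realType) (t : R) (v : R -> R) (dv : R) : Prop :=
  (fun h => h^-1 * (v (t + h) - v t)) @ within [set h | 0 <= t + h] 0^' --> dv.

Definition is_dt (R : realType) (V W : R3 R -> R -> R[i]) : Prop :=
  forall x t, 0 <= t ->
    is_derive_ge0 t (fun r => complex.Re (V x r)) (complex.Re (W x t)) /\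
    is_derive_ge0 t (fun r => complex.Im (V x r)) (complex.Im (W x t)).

Fixpoint iter_deriv (T : Type) (D : T -> T -> Prop) (n : nat) (V W : T) : Prop :=
  if n is n'.+1 then exists2 V', iter_deriv D n' V V' & D V' W else W = V.

(** All the intermediate derivatives exist and W is the derivative of V of order
    j in t, then alpha_3 in x_3, alpha_2 in x_2 and alpha_1 in x_1. *)
Definition is_mixed_deriv (R : realType) (alpha : nat * nat * nat) (j : nat)
    (V W : R3 R -> R -> R[i]) : Prop :=
  exists V0 V3 V2 : R3 R -> R -> R[i],
    [/\ iter_deriv (@is_dt R) j V V0,
        iter_deriv (is_dx (0, 0, 1)) alpha.2 V0 V3,
        iter_deriv (is_dx (0, 1, 0)) alpha.1.2 V3 V2 &
        iter_deriv (is_dx (1, 0, 0)) alpha.1.1 V2 W].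

Definition order_alpha (alpha : nat * nat * nat) : nat :=
  (alpha.1.1 + alpha.1.2 + alpha.2)%N.

Definition sup_norm (R : realType) (g : R3 R -> R[i]) : \bar R :=
  ereal_sup [set (ComplexField.Normc.normc (g x))%:E | x in [set: R3 R]].

(* Main.v *)
Require Import Defs.
From HB Require Import structures.
From mathcomp Require Import all_boot all_order all_algebra.
From mathcomp Require Import complex.
From mathcomp Require Import all_classical all_reals all_analysis.
From mathcomp Require Import measurable_realfun ring lra.
Import Order.TTheory GRing.Theory Num.Theory.
Import numFieldNormedType.Exports.
Local Open Scope classical_set_scope.
Local Open Scope ring_scope.

(** With rho = |xi|^2 the multiplier is real and solves the damped oscillator
    m'' + sigma m' + rho^2 m = 0, m(0) = 0, m'(0) = 1.  The Lyapunov function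
    (m' + sigma m / 2)^2 + (sigma^2 / 4 + rho^2) m^2 equals 1 at t = 0 and
    decays at least at the rate sigma rho^2 / (2 (rho^2 + sigma^2)), uniformly across
    the sphere where the characteristic roots coincide.  Hence the j-th time
    derivative is O(e^(- k rho^2 t)) for rho <= 1 and
    O(rho^(j - 1) e^(- k t)) for rho >= 1.  The low frequencies are integrated
    against |fourier f| <= C |f|_1 and give the power of 1 + t; the high
    frequencies are treated by Cauchy-Schwarz against the H^s norm, the weight
    (1 + rho)^(2 j + |alpha| - 2 - s) being integrable on R^3 exactly when
    s > 2 j + |alpha| - 1/2.  The same bounds dominate the differentiations
    under the integral sign.  For s = 0 the H^s norm is compared with the L^2
    norm through the Plancherel inequality, proved by Abel summation: the
    weight e^(- e (|xi_1| + |xi_2| + |xi_3|)) has a positive Fourier transform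
    of integral (2 pi)^3, whatever e > 0. *)

Set Implicit Arguments.
Unset Strict Implicit.
Unset Printing Implicit Defensive.

(** * One-dimensional integrals *)

(** The closed formula for the multiplier changes character across the sphere sigma^2 = 4 rho^2, so
    it serves only to identify the multiplier; every bound on it comes from the energy, whose
    derivative is a quadratic form free of the discriminant. Integrals over R^3 are reduced to
    one-dimensional ones by dominating radial functions with tensor products, so no polar
    coordinates appear. The kernel a / (1 + (a y)^2) has mass pi for every a > 0 and carries all
    scalings: a = (1 + t)^(1/4) produces the power of 1 + t, and a = 1 / e gives half the transform
    of e^(- e |x|). Time derivatives at t = 0 come from two-sided limits, the formulas being
    extended to t > -1; hence the energy is also bounded backward in time. One weight, (1 + rho)^(j
    + n / 2 - 1) with n = |alpha|, dominates all intermediate derivatives. The Fourier constants are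
    not sharp, because real and imaginary parts are estimated separately. *)

Lemma ge0_integrable (R : realType) d (T : measurableType d) (mu : {measure set T -> \bar R})
    (f : T -> R) : measurable_fun setT f -> (forall x, 0 <= f x) ->
  (\int[mu]_x (f x)%:E < +oo)%E -> mu.-integrable setT (EFin \o f).
Proof.
move=> mf f0 foo; apply/integrableP; split; first exact/measurable_EFinP.
apply: le_lt_trans foo; rewrite le_eqVlt; apply/orP; left; apply/eqP.
by apply: eq_integral => x _ /=; rewrite ger0_norm.
Qed.

Lemma integrableZl_EFin (R : realType) d (T : measurableType d) (mu : {measure set T -> \bar R})
    (r : R) (f : T -> R) : mu.-integrable setT (EFin \o f) ->
  mu.-integrable setT (EFin \o (fun x => r * f x)).
Proof. by move=> jf; exact: (integrableZl measurableT r jf). Qed.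

Section HalfLineIntegrals.
Variable R : realType.
Let mu := @lebesgue_measure R.

Lemma ge0_integralT_split (g : R -> R) : (forall x, 0 <= g x) -> continuous g ->
  (\int[mu]_x (g x)%:E = \int[mu]_(x in `[0%R, +oo[) (g x)%:E +
     \int[mu]_(x in `[0%R, +oo[) (g (- x))%:E)%E.
Proof.
move=> g0 cg.
have mg : measurable_fun [set: R] g by exact: continuous_measurable_fun.
have mposnums : measurable [set x : R | 0 <= x]%R by rewrite -set_itvcy.
rewrite -(setUv [set x : R | 0 <= x]%R) ge0_integral_setU//= ; last 4 first.
  exact: measurableC.
  by apply/measurable_EFinP; rewrite setUv.
  by move=> x _; rewrite lee_fin.
  exact/disj_setPCl.
rewrite -set_itvcy//; congr (_ + _)%E.
rewrite setCitvr integral_itv_bndo_bndc; last exact/measurable_EFinP/measurable_funTS.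
rewrite -{1}oppr0 ge0_integration_by_substitutionNy//.
exact: continuous_subspaceT.
Qed.

Lemma ge0_integral0y_FTC (g G : R -> R) (l : R) :
  (forall x, 0 <= x -> 0 <= g x) ->
  (forall x, 0 <= x -> {for x, continuous g}) ->
  (forall x : R, 0 <= x -> is_derive x 1 G (g x)) -> G @ +oo --> l ->
  (\int[mu]_(x in `[0%R, +oo[) (g x)%:E = (l - G 0)%:E)%E.
Proof.
move=> g0 cg dG Gl; rewrite (@ge0_continuous_FTC2y R g G 0 l) //.
- apply/continuous_within_itvcyP; split.
    by move=> x; rewrite in_itv/= andbT => x0; apply: cg; exact: ltW.
  exact/cvg_at_right_filter/cg.
- by move=> x x0; have [] := dG _ (ltW x0).
- apply/cvg_at_right_filter/differentiable_continuous/derivable1_diffP.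
  by have [] := dG _ (lexx 0).
- by move=> x; rewrite in_itv/= andbT => x0; rewrite derive1E; have [] := dG _ (ltW x0).
Qed.

Lemma cvg_affy (a b : R) : 0 < a -> a * x + b @[x --> (+oo : set_system R)] --> +oo.
Proof.
move=> a0; apply/cvgryPge => A.
near=> x.
have : (A - b) / a <= x by near: x; apply: nbhs_pinfty_ge; rewrite num_real.
by rewrite ler_pdivrMr // mulrC lerBlDr.
Unshelve. all: by end_near. Qed.

Lemma integralT_poisson (a x : R) : 0 < a ->
  (\int[mu]_y (a / (1 + (a * (y - x)) ^+ 2))%:E = pi%:E)%E.
Proof.
move=> a0.
have p0 z : 0 < 1 + (a * z) ^+ 2 by rewrite ltr_wpDr// ?sqr_ge0.
have cf (z : R) : continuous (fun y : R => a / (1 + (a * (y - z)) ^+ 2)).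
  move=> y; apply: cvgM; first exact: cvg_cst.
  apply: cvgV; first by rewrite gt_eqF.
  apply: cvgD; first exact: cvg_cst.
  apply: (@cvg_comp _ _ _ (fun y : R => a * (y - z)) (fun u => u ^+ 2)); last exact: exprn_continuous.
  apply: cvgM; first exact: cvg_cst.
  by apply: cvgB; [exact: cvg_id|exact: cvg_cst].
(* The centre is left free so that the reflected half-line is the same statement with centre -x; the
   two arctangents then cancel. *)
have key z : (\int[mu]_(y in `[0%R, +oo[) (a / (1 + (a * (y - z)) ^+ 2))%:E =
    (pi / 2 + atan (a * z))%:E)%E.
  have dG (y : R) : 0 <= y -> is_derive y 1 (fun y => atan (a * y - a * z)) (a / (1 + (a * (y - z)) ^+ 2)).
    move=> _; apply: is_derive_eq.
    by rewrite /= -mulrBr subr0 /GRing.scale/= mulr1 mulrC.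
  rewrite (@ge0_integral0y_FTC _ _ (pi / 2) _ _ dG) //.
  - by rewrite mulr0 sub0r atanN opprK.
  - by move=> y _; rewrite divr_ge0 ?ltW.
  - by move=> y _; exact: cf.
  - apply: (@cvg_comp _ _ _ (fun y : R => a * y + (- (a * z))) (@atan R) _ +oo%R);
      [exact: cvg_affy|exact: cvgy_atan].
rewrite (ge0_integralT_split _ (cf x)) => [|y]; last by rewrite divr_ge0 ?ltW.
rewrite key.
have E (y : R) : a / (1 + (a * (- y - x)) ^+ 2) = a / (1 + (a * (y - - x)) ^+ 2).
  by rewrite -(sqrrN (a * (y - - x))); congr (a / (1 + _ ^+ 2)); ring.
under [X in (_ + X)%E]eq_integral => y _ do rewrite E.
rewrite key mulrN atanN -EFinD; congr (_%:E); lra.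
Qed.

End HalfLineIntegrals.

(** * Explicit integrals: Laplace weights and negative powers of 1 + x^2 *)

Section ExplicitIntegrals.
Variable R : realType.
Let mu := @lebesgue_measure R.

Lemma continuous_laplace_cos (e p z : R) :
  continuous (fun y : R => expR (- (e * `|y|)) * (1 + cos (p + z * y))).
Proof.
move=> y; apply: cvgM.
  apply: (@cvg_comp _ _ _ (fun y : R => - (e * `|y|)) (@expR R)); last exact: continuous_expR.
  by apply: cvgN; apply: cvgM; [exact: cvg_cst|exact: norm_continuous].
apply: cvgD; first exact: cvg_cst.
apply: (@cvg_comp _ _ _ (fun y : R => p + z * y) (@cos R)); last exact: continuous_cos.
by apply: cvgD; [exact: cvg_cst|apply: cvgM; [exact: cvg_cst|exact: cvg_id]].
Qed.

(** The summand 1 makes the integrand nonnegative, so the fundamental theorem on the half-line gives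
    convergence and value together. The phase p is what later allows the passage to several
    variables. *)
Lemma integral0y_laplace_cos (e p z : R) : 0 < e ->
  (\int[mu]_(y in `[0%R, +oo[) (expR (- (e * `|y|)) * (1 + cos (p + z * y)))%:E =
   (e^-1 + (e * cos p - z * sin p) / (e ^+ 2 + z ^+ 2))%:E)%E.
Proof.
move=> e0.
have d0 : e ^+ 2 + z ^+ 2 != 0 by rewrite gt_eqF// ltr_wpDr ?sqr_ge0 ?exprn_gt0.
have en0 : e != 0 by rewrite gt_eqF.
pose G (y : R) := - (expR (- (e * y)) *
  (e^-1 + (e * cos (p + z * y) - z * sin (p + z * y)) / (e ^+ 2 + z ^+ 2))).
have dG (y : R) : 0 <= y ->
    is_derive y 1 G (expR (- (e * `|y|)) * (1 + cos (p + z * y))).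
  move=> y0; rewrite (ger0_norm y0); apply: is_derive_eq.
  rewrite /= /GRing.scale/= .
  field; by apply/andP.
rewrite (@ge0_integral0y_FTC _ _ _ 0 _ _ dG).
- congr (_%:E); rewrite /G !mulr0 oppr0 expR0 addr0; ring.
- by move=> y _; rewrite mulr_ge0 ?expR_ge0// -lerBlDl sub0r cos_geN1.
- by move=> y _; exact: continuous_laplace_cos.
have -> : 0 = - (0 : R) by rewrite oppr0.
apply: cvgN.
pose M := e^-1 + (e + `|z|) / (e ^+ 2 + z ^+ 2).
have ei : 0 <= e^-1 by rewrite invr_ge0 ltW.
have B (y : R) : `|expR (- (e * y)) *
  (e^-1 + (e * cos (p + z * y) - z * sin (p + z * y)) / (e ^+ 2 + z ^+ 2))| <= expR (- (e * y)) * M.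
  rewrite normrM (ger0_norm (expR_ge0 _)) ler_wpM2l ?expR_ge0//.
  rewrite (le_trans (ler_normD _ _))// (ger0_norm ei) /M lerD2l.
  rewrite normrM (@ger0_norm _ (_^-1)) ?invr_ge0 ?addr_ge0 ?sqr_ge0//.
  rewrite ler_wpM2r ?invr_ge0 ?addr_ge0 ?sqr_ge0//.
  rewrite (le_trans (ler_normB _ _))// !normrM (ger0_norm (ltW e0)).
  by apply: lerD; rewrite ler_piMr ?normr_ge0 ?(ltW e0)// ler_norml ?cos_geN1 ?cos_le1 ?sin_geN1 ?sin_le1.
apply: norm_cvg0.
apply: (@squeeze_cvgr _ _ _ _ (cst 0) (fun y => expR (- (e * y)) * M)).
- by apply: nearW => y; rewrite normr_ge0 B.
- exact: cvg_cst.
rewrite -[X in _ --> X](mul0r M); apply: cvgM; last exact: cvg_cst.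
apply: (@cvg_comp _ _ _ (fun y : R => e * y) (fun u : R => expR (- u)) _ +oo%R); last exact: cvgr_expR.
have := @cvg_affy R e 0 e0.
by under eq_fun do rewrite addr0.
Qed.

Lemma integralT_laplace_cos1 (e p z : R) : 0 < e ->
  (\int[mu]_y (expR (- (e * `|y|)) * (1 + cos (p + z * y)))%:E =
   (2 / e + 2 * e * cos p / (e ^+ 2 + z ^+ 2))%:E)%E.
Proof.
move=> e0; rewrite (ge0_integralT_split _ (@continuous_laplace_cos e p z)) => [|y]; last first.
  by rewrite mulr_ge0 ?expR_ge0// -lerBlDl sub0r cos_geN1.
rewrite integral0y_laplace_cos//.
have E (y : R) : expR (- (e * `|- y|)) * (1 + cos (p + z * - y)) =
   expR (- (e * `|y|)) * (1 + cos (p + (- z) * y)) by rewrite normrN mulrN mulNr.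
under [X in (_ + X)%E]eq_integral => y _ do rewrite E.
by rewrite integral0y_laplace_cos// -EFinD sqrrN; congr (_%:E); lra.
Qed.

Lemma integralT_laplace (e : R) : 0 < e ->
  (\int[mu]_y (expR (- (e * `|y|)))%:E = (2 / e)%:E)%E.
Proof.
(* Phase pi / 2 at frequency 0 kills the cosine and leaves the bare exponential. *)
move=> e0; have := @integralT_laplace_cos1 e (pi / 2) 0 e0.
rewrite cos_pihalf mulr0 mul0r addr0 => <-.
by apply: eq_integral => y _; rewrite mul0r addr0 cos_pihalf addr0 mulr1.
Qed.

Lemma measurable_laplace (e : R) : measurable_fun setT (fun y : R => expR (- (e * `|y|))).
Proof.
apply: continuous_measurable_fun => y.
apply: (@cvg_comp _ _ _ (fun y : R => - (e * `|y|)) (@expR R)); last exact: continuous_expR.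
by apply: cvgN; apply: cvgM; [exact: cvg_cst|exact: norm_continuous].
Qed.

Lemma integrable_laplace (e : R) : 0 < e ->
  mu.-integrable setT (EFin \o (fun y : R => expR (- (e * `|y|)))).
Proof.
move=> e0; apply: ge0_integrable; first exact: measurable_laplace.
  by move=> x; exact: expR_ge0.
by rewrite integralT_laplace// ltry.
Qed.

Lemma integralT_laplace_cos (e p z : R) : 0 < e ->
  \int[mu]_y (expR (- (e * `|y|)) * cos (p + z * y)) =
   cos p * (2 * e / (e ^+ 2 + z ^+ 2)).
Proof.
move=> e0.
have iL := integrable_laplace e0.
have i1 : mu.-integrable setT
    (EFin \o (fun y : R => expR (- (e * `|y|)) * (1 + cos (p + z * y)))).
  apply: ge0_integrable.
  - by apply: continuous_measurable_fun; exact: continuous_laplace_cos.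
  - by move=> y; rewrite mulr_ge0 ?expR_ge0// -lerBlDl sub0r cos_geN1.
  - by rewrite integralT_laplace_cos1// ltry.
have -> : \int[mu]_y (expR (- (e * `|y|)) * cos (p + z * y)) =
  \int[mu]_y (expR (- (e * `|y|)) * (1 + cos (p + z * y)) - expR (- (e * `|y|))).
  by apply: eq_Rintegral => y _; rewrite mulrDr mulr1 addrAC subrr add0r.
rewrite RintegralB// /Rintegral integralT_laplace_cos1// integralT_laplace//=.
by rewrite addrAC subrr add0r; ring.
Qed.

Lemma cvgy_ln : @ln R @ +oo --> +oo.
Proof.
apply/cvgryPge => A; near=> x.
have Ax : expR A <= x by near: x; apply: nbhs_pinfty_ge; rewrite num_real.
by rewrite -ler_expR lnK// posrE (lt_le_trans (expR_gt0 A)).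
Unshelve. all: by end_near. Qed.

Lemma cvgy_powRN (p : R) : 0 < p -> @powR R ^~ (- p) @ +oo --> 0.
Proof.
move=> p0.
have E : \forall x \near (+oo : set_system R), expR (- (p * ln x)) = x `^ (- p).
  near=> x; have x0 : 0 < x by near: x; apply: nbhs_pinfty_gt; rewrite num_real.
  by rewrite /powR gt_eqF// mulNr.
apply: (cvg_trans (near_eq_cvg E)).
apply: (@cvg_comp _ _ _ (fun y : R => p * ln y) (fun u : R => expR (- u)) _ +oo%R); last exact: cvgr_expR.
apply: (@cvg_comp _ _ _ (@ln R) (fun y : R => p * y) _ +oo%R); first exact: cvgy_ln.
by have := @cvg_affy R p 0 p0; under eq_fun do rewrite addr0.
Unshelve. all: by end_near. Qed.

Lemma integralT_japanese_lty (g : R) : 1 / 2 < g ->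
  (\int[mu]_x ((1 + x ^+ 2) `^ (- g))%:E < +oo)%E.
Proof.
move=> g12.
pose h (x : R) := (1 + `|x|) `^ (- (2 * g)).
have px (x : R) : 0 < 1 + `|x| by rewrite ltr_pwDl.
have qx (x : R) : 0 < 1 + x ^+ 2 by rewrite ltr_pwDl ?sqr_ge0.
have ch : continuous h.
  move=> x; apply: (@cvg_comp _ _ _ (fun x : R => 1 + `|x|) (fun u => u `^ (- (2 * g)))).
    by apply: cvgD; [exact: cvg_cst|exact: norm_continuous].
  have d : derivable (@powR R ^~ (- (2 * g))) (1 + `|x|) 1.
    by apply: derivable_powR; rewrite in_itv/= px.
  by have /derivable1_diffP/differentiable_continuous := d.
have half : (\int[mu]_(x in `[0%R, +oo[) (h x)%:E = ((2 * g - 1)^-1)%:E)%E.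
  pose G (x : R) := - ((2 * g - 1)^-1 * (1 + x) `^ (1 - 2 * g)).
  have dG (x : R) : 0 <= x -> is_derive x 1 G (h x).
    move=> x0; have x1 : 0 < 1 + x by rewrite ltr_pwDl.
    have d1 := is_derive1_powR (1 - 2 * g) x1.
    rewrite (_ : 1 - 2 * g - 1 = - (2 * g)) in d1; last by ring.
    have d2 : is_derive x 1 (fun x : R => 1 + x) 1.
      by apply: is_derive_eq; rewrite add0r mulr1.
    have d3 := is_derive1_comp d1 d2.
    rewrite /G /h (ger0_norm x0); apply: is_derive_eq.
    rewrite /= /GRing.scale/=. field. lra.
  rewrite (@ge0_integral0y_FTC _ _ _ 0 _ _ dG).
  - by rewrite /G addr0 powR1 mulr1 sub0r opprK.
  - by move=> x _; exact: powR_ge0.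
  - by move=> x _; exact: ch.
  have -> : 0 = - ((2 * g - 1)^-1 * 0) :> R by rewrite mulr0 oppr0.
  apply: cvgN; apply: cvgM; first exact: cvg_cst.
  have gp : 0 < 2 * g - 1 by lra.
  apply: (@cvg_comp _ _ _ (fun x : R => 1 + x) (fun x : R => x `^ (1 - 2 * g)) _ +oo%R).
    by have := @cvg_affy R 1 1 ltr01; under eq_fun do rewrite mul1r addrC.
  by have := @cvgy_powRN (2 * g - 1) gp; rewrite opprB.
have mh : measurable_fun setT h by exact: continuous_measurable_fun.
have mj : measurable_fun setT (fun x : R => (1 + x ^+ 2) `^ (- g)).
  apply: (@measurableT_comp _ _ _ _ _ _ (@powR R ^~ (- g))) => //.
  by apply: measurable_funD => //; exact: measurable_funX.
(* Since (1 + |x|)^2 <= 2 (1 + x^2), the function h, which has an explicit antiderivative on the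
   half-line, dominates up to the factor 2^g. *)
apply: (@le_lt_trans _ _ (\int[mu]_x (2 `^ g * h x)%:E)%E).
  apply: ge0_le_integral => //.
  - by move=> x _; rewrite lee_fin powR_ge0.
  - exact/measurable_EFinP.
  - by apply/measurable_EFinP; apply: measurable_funM.
  move=> x _; rewrite lee_fin /h.
  have -> : - (2 * g) = 2 * - g by ring.
  have p1 := ltW (px x); have q1 := ltW (qx x).
  rewrite powRrM powR_mulrn// !powRN.
  rewrite -[leLHS]mul1r ler_pdivrMr ?powR_gt0// mulrAC ler_pdivlMr ?powR_gt0 ?exprn_gt0//.
  rewrite mul1r -powRM// ge0_ler_powR ?nnegrE ?mulr_ge0 ?exprn_ge0//; first lra.
  rewrite -(real_normK (num_real x)).
  have := sqr_ge0 (1 - `|x|); lra.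
under eq_integral do rewrite EFinM.
rewrite ge0_integralZl//.
- rewrite (ge0_integralT_split _ ch) => [|x]; last exact: powR_ge0.
  have E (x : R) : h (- x) = h x by rewrite /h normrN.
  under [X in (_ * (_ + X))%E]eq_integral => x _ do rewrite E.
  by rewrite half -EFinD -EFinM ltry.
- exact/measurable_EFinP.
- by move=> x _; rewrite lee_fin powR_ge0.
Qed.

End ExplicitIntegrals.

(** * The damped oscillator *)

Section DampedOscillator.
Variable R : realType.
Implicit Types a t sigma rho : R.

Lemma homo_le_of_derive_le0 (f df : R -> R) : (forall t, is_derive t 1 f (df t)) ->
  (forall t, df t <= 0) -> {homo f : x y /~ x <= y}.
Proof.
move=> fdf df0 x y xy.
apply: (@ler0_derive1_nincry _ _ y) => //.
- by move=> z _; rewrite derive1E; have [_ ->] := fdf z.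
- apply: continuous_subspaceT => z; apply/differentiable_continuous/derivable1_diffP.
  by have [] := fdf z.
Qed.

(** With a the discriminant, this is 2 sinh (t sqrt a / 2) / sqrt a, continued through a = 0 to a
    sine for a < 0; [osc_cos] is its derivative in t. Both are real in the three regimes. *)
Definition osc_sin a t : R :=
  if a == 0 then t else
  if 0 <= a then (expR (t / 2 * Num.sqrt a) - expR (- (t / 2 * Num.sqrt a))) / Num.sqrt a
  else 2 * sin (t / 2 * Num.sqrt (- a)) / Num.sqrt (- a).

Definition osc_cos a t : R :=
  if a == 0 then 1 else
  if 0 <= a then (expR (t / 2 * Num.sqrt a) + expR (- (t / 2 * Num.sqrt a))) / 2
  else cos (t / 2 * Num.sqrt (- a)).

Lemma is_derive_osc_sin a t : is_derive t 1 (osc_sin a) (osc_cos a t).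
Proof.
rewrite /osc_sin /osc_cos; have [_|a0] := eqVneq a 0; first exact: is_derive_id.
have [age0|alt0] := leP 0 a.
  have s0 : Num.sqrt a != 0 by rewrite gt_eqF// sqrtr_gt0 lt_neqAle eq_sym a0.
  by apply: is_derive_eq; rewrite /GRing.scale/=; field.
have s0 : Num.sqrt (- a) != 0 by rewrite gt_eqF// sqrtr_gt0 oppr_gt0.
by apply: is_derive_eq; rewrite /GRing.scale/=; field.
Qed.

Lemma is_derive_osc_cos a t : is_derive t 1 (osc_cos a) (a / 4 * osc_sin a t).
Proof.
rewrite /osc_sin /osc_cos; have [->|a0] := eqVneq a 0.
  by rewrite mul0r mul0r; exact: is_derive_cst.
have [age0|alt0] := leP 0 a.
  have s0 : Num.sqrt a != 0 by rewrite gt_eqF// sqrtr_gt0 lt_neqAle eq_sym a0.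
  apply: is_derive_eq; rewrite /GRing.scale/= -[X in _ = X / 4 * _](sqr_sqrtr age0).
  by field.
have s0 : Num.sqrt (- a) != 0 by rewrite gt_eqF// sqrtr_gt0 oppr_gt0.
have age0 : 0 <= - a by rewrite oppr_ge0 ltW.
apply: is_derive_eq; rewrite /GRing.scale/= -[X in _ = X / 4 * _]opprK -[X in _ = - X / 4 * _](sqr_sqrtr age0).
by field.
Qed.

Lemma osc_sin0 a : osc_sin a 0 = 0.
Proof.
by rewrite /osc_sin !mul0r oppr0 subrr sin0 mulr0 !mul0r; case: ifP => // _; case: ifP.
Qed.

Lemma osc_cos0 a : osc_cos a 0 = 1.
Proof.
rewrite /osc_cos !mul0r oppr0 expR0 cos0; case: ifP => // _; case: ifP => // _.
by rewrite divff.
Qed.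

(** [dmult sigma rho k t] is the k-th derivative at t of the solution of
    m'' + sigma m' + rho^2 m = 0, m 0 = 0, m' 0 = 1. *)
Fixpoint dmult sigma rho (k : nat) t : R :=
  let a := sigma ^+ 2 - 4 * rho ^+ 2 in
  match k with
  | 0 => expR (- (sigma / 2 * t)) * osc_sin a t
  | k'.+1 => match k' with
    | 0 => expR (- (sigma / 2 * t)) * (osc_cos a t - sigma / 2 * osc_sin a t)
    | k''.+1 => - sigma * dmult sigma rho k' t - rho ^+ 2 * dmult sigma rho k'' t
    end
  end.

Lemma dmultSS sigma rho k t : dmult sigma rho k.+2 t =
  - sigma * dmult sigma rho k.+1 t - rho ^+ 2 * dmult sigma rho k t.
Proof. by []. Qed.

Lemma is_derive_dmult sigma rho k t :
  is_derive t 1 (dmult sigma rho k) (dmult sigma rho k.+1 t).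
Proof.
(* The recursion looks two orders back, so the induction carries two consecutive derivatives. *)
suff : is_derive t 1 (dmult sigma rho k) (dmult sigma rho k.+1 t) /\
   is_derive t 1 (dmult sigma rho k.+1) (dmult sigma rho k.+2 t) by case.
elim: k => [|k [ih1 ih2]].
  have d1 := is_derive_osc_sin; have d2 := is_derive_osc_cos.
  split; apply: is_derive_eq; rewrite /= /GRing.scale/=; by field.
have d : is_derive t 1 (dmult sigma rho k.+2) (dmult sigma rho k.+3 t).
  rewrite (_ : dmult sigma rho k.+2 =
      (- sigma \*: dmult sigma rho k.+1) - (rho ^+ 2 \*: dmult sigma rho k)) //.
  by rewrite dmultSS; apply: is_derive_eq.
by [].
Qed.

(** The plain energy m'^2 + rho^2 m^2 dissipates only m'^2. Shifting m' by sigma m / 2 brings rho^2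
    m^2 into the dissipation; the coefficient sigma^2 / 4 cancels the cross term m m' created by the
    shift and keeps control of m as rho tends to 0. *)
Definition energy sigma rho t : R :=
  (dmult sigma rho 1 t + sigma / 2 * dmult sigma rho 0 t) ^+ 2 +
  (sigma ^+ 2 / 4 + rho ^+ 2) * dmult sigma rho 0 t ^+ 2.

Lemma energy0 sigma rho : energy sigma rho 0 = 1.
Proof.
by rewrite /energy /= osc_sin0 osc_cos0 !mulr0 oppr0 expR0; field.
Qed.

Lemma is_derive_energy sigma rho t : is_derive t 1 (energy sigma rho)
  (- (sigma * (dmult sigma rho 1 t ^+ 2 + rho ^+ 2 * dmult sigma rho 0 t ^+ 2))).
Proof.
have d := is_derive_dmult sigma rho; rewrite /energy.
apply: is_derive_eq; rewrite dmultSS /GRing.scale/=.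
move: (dmult sigma rho 0 t) (dmult sigma rho 1 t) => u v.
by field.
Qed.

(** A Gronwall argument: e^(c t) times the energy is nonincreasing as soon as c times the energy is
    at most the dissipation. *)
Lemma energy_decay sigma rho t : 0 < sigma -> 0 <= t ->
  energy sigma rho t <=
  expR (- (sigma * rho ^+ 2 / (2 * (rho ^+ 2 + sigma ^+ 2)) * t)).
Proof.
move=> s0 t0; set c := _ / _.
have d := is_derive_energy sigma rho.
have p0 : 0 < rho ^+ 2 + sigma ^+ 2 by rewrite ltr_wpDl ?sqr_ge0 ?exprn_gt0.
pose df t := expR (c * t) * (c * energy sigma rho t -
   (sigma * (dmult sigma rho 1 t ^+ 2 + rho ^+ 2 * dmult sigma rho 0 t ^+ 2))).
have fdf t1 : is_derive t1 1 (fun t => expR (c * t) * energy sigma rho t) (df t1).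
  by apply: is_derive_eq; rewrite /df /GRing.scale/=; ring.
have df0 t1 : df t1 <= 0.
  rewrite /df pmulr_rle0 ?expR_gt0// subr_le0 /energy /c.
  move: (dmult sigma rho 0 t1) (dmult sigma rho 1 t1) => u v.
  (* The energy is at most 2 v^2 + (rho^2 + sigma^2) u^2. Its u^2 part must be paid by the
     dissipated rho^2 u^2, which forces the factor rho^2 and hence the rate c. *)
  have H : rho ^+ 2 * ((v + sigma / 2 * u) ^+ 2 + (sigma ^+ 2 / 4 + rho ^+ 2) * u ^+ 2) <=
      2 * (rho ^+ 2 + sigma ^+ 2) * (v ^+ 2 + rho ^+ 2 * u ^+ 2).
    apply: (@le_trans _ _ (rho ^+ 2 * (2 * v ^+ 2 + (rho ^+ 2 + sigma ^+ 2) * u ^+ 2))).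
      rewrite ler_wpM2l ?sqr_ge0//.
      have := sqr_ge0 (v - sigma / 2 * u); have := mulr_ge0 (sqr_ge0 sigma) (sqr_ge0 u); lra.
    rewrite -subr_ge0.
    rewrite (_ : _ - _ = 2 * (sigma ^+ 2 * v ^+ 2) + (rho ^+ 2 + sigma ^+ 2) * (rho ^+ 2 * u ^+ 2)); last by ring.
    have q1 := mulr_ge0 (sqr_ge0 sigma) (sqr_ge0 v).
    by have q2 := mulr_ge0 (ltW p0) (mulr_ge0 (sqr_ge0 rho) (sqr_ge0 u)); lra.
  rewrite mulrAC ler_pdivrMr ?mulr_gt0//.
  by have := ler_wpM2l (ltW s0) H; lra.
have := homo_le_of_derive_le0 fdf df0 t0.
rewrite mulr0 expR0 mul1r energy0 => h.
by rewrite expRN -[leRHS]mulr1 ler_pdivlMl ?expR_gt0.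
Qed.

(** Backward in time the energy grows, but at a rate independent of rho, because the dissipation is
    at most 2 sigma times the energy. This covers the times in [-1, 0] used to differentiate at t =
    0. *)
Lemma energy_backward sigma rho t : 0 < sigma -> t <= 0 ->
  energy sigma rho t <= expR (- (2 * sigma * t)).
Proof.
move=> s0 t0.
have d := is_derive_energy sigma rho.
pose df t := expR (2 * sigma * t) * (- (2 * sigma * energy sigma rho t) +
   (sigma * (dmult sigma rho 1 t ^+ 2 + rho ^+ 2 * dmult sigma rho 0 t ^+ 2))).
have fdf t1 : is_derive t1 1 (fun t => - (expR (2 * sigma * t) * energy sigma rho t)) (df t1).
  by apply: is_derive_eq; rewrite /df /GRing.scale/=; ring.
have df0 t1 : df t1 <= 0.
  rewrite /df pmulr_rle0 ?expR_gt0// addrC subr_le0 /energy.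
  move: (dmult sigma rho 0 t1) (dmult sigma rho 1 t1) => u v.
  have H : v ^+ 2 + rho ^+ 2 * u ^+ 2 <=
      2 * ((v + sigma / 2 * u) ^+ 2 + (sigma ^+ 2 / 4 + rho ^+ 2) * u ^+ 2).
    have := sqr_ge0 (v + sigma * u); have := mulr_ge0 (sqr_ge0 rho) (sqr_ge0 u); lra.
  by have := ler_wpM2l (ltW s0) H; lra.
have := homo_le_of_derive_le0 fdf df0 t0.
rewrite mulr0 expR0 mul1r energy0 lerN2 => h.
by rewrite expRN -[leRHS]mulr1 ler_pdivlMl ?expR_gt0.
Qed.

(** The factor 1 + rho avoids the exponent k - 1, which is negative for k = 0. *)
Lemma dmult_le_energy sigma (k : nat) : 0 < sigma -> exists2 A, 0 < A &
  forall rho t B, 0 <= rho -> 0 <= B -> energy sigma rho t <= B ^+ 2 ->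
    (1 + rho) * `|dmult sigma rho k t| <= A * (1 + rho) ^+ k * B.
Proof.
move=> s0.
(* Two consecutive orders are carried, as the recursion requires. The square root B of the energy
   bound stays free: it will be a decaying exponential for t >= 0 and the constant e^sigma for t >=
   -1. *)
suff : exists A A', [/\ 0 < A, 0 < A' & forall rho t B, 0 <= rho -> 0 <= B ->
    energy sigma rho t <= B ^+ 2 ->
    (1 + rho) * `|dmult sigma rho k t| <= A * (1 + rho) ^+ k * B /\
    (1 + rho) * `|dmult sigma rho k.+1 t| <= A' * (1 + rho) ^+ k.+1 * B].
  by move=> [A [A' [A0 _ h]]]; exists A => // *; apply: (h _ _ _ _ _ _).1.
have half0 : 0 < sigma / 2 by rewrite divr_gt0.
elim: k => [|k [A [A' [A0 A'0 h]]]].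
  exists (1 + 2 / sigma), 2; split; rewrite ?addr_gt0 ?divr_gt0//.
  move=> rho t B r0 B0; rewrite /energy.
  move: (dmult sigma rho 0 t) (dmult sigma rho 1 t) => u v h.
  have q1 := sqr_ge0 (v + sigma / 2 * u).
  have q2 := mulr_ge0 (sqr_ge0 (sigma / 2)) (sqr_ge0 u).
  have q3 := mulr_ge0 (sqr_ge0 rho) (sqr_ge0 u).
  have leB x : x ^+ 2 <= B ^+ 2 -> `|x| <= B.
    by rewrite -(real_normK (num_real x)) ler_pXn2r.
  have e4 : (sigma / 2) ^+ 2 = sigma ^+ 2 / 4 by field.
  have h1 : sigma / 2 * `|u| <= B.
    rewrite -[sigma / 2]ger0_norm ?(ltW half0)// -normrM; apply: leB.
    by rewrite exprMn; move: q2 h; rewrite e4; lra.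
  have h2 : rho * `|u| <= B.
    by rewrite -[rho]ger0_norm// -normrM; apply: leB; rewrite exprMn; move: q2; rewrite e4; lra.
  have h3 : `|v + sigma / 2 * u| <= B by apply: leB; move: q2; rewrite e4; lra.
  have h4 : `|v| <= 2 * B.
    rewrite -[v](addrK (sigma / 2 * u)) (le_trans (ler_normB _ _))//.
    by rewrite normrM (ger0_norm (ltW half0)); lra.
  rewrite expr0 expr1; split; last by rewrite mulrAC mulrC ler_wpM2r// addr_ge0.
  have h5 : `|u| <= 2 / sigma * B by rewrite mulrAC ler_pdivlMr//; move: h1; lra.
  lra.
exists A', (sigma * A' + A); split => //; first by rewrite addr_gt0// mulr_gt0.
move=> rho t B r0 B0 hB; have [h1 h2] := h _ _ _ r0 B0 hB.
split=> //; rewrite dmultSS.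
have p1 : 0 <= 1 + rho by rewrite addr_ge0.
(* The restoring term costs rho^2 <= (1 + rho)^2, two powers for two orders; the damping term has
   one power to spare. *)
apply: (@le_trans _ _ (sigma * ((1 + rho) * `|dmult sigma rho k.+1 t|) +
    (1 + rho) ^+ 2 * ((1 + rho) * `|dmult sigma rho k t|))).
  rewrite (mulrCA sigma) (mulrCA _ (1 + rho)) -mulrDr ler_wpM2l//.
  rewrite (le_trans (ler_normB _ _))// !normrM normrN (gtr0_norm s0).
  rewrite lerD2l ger0_norm ?sqr_ge0//; apply: ler_wpM2r => //; nra.
apply: (@le_trans _ _ (sigma * (A' * (1 + rho) ^+ k.+1 * B) + (1 + rho) ^+ 2 * (A * (1 + rho) ^+ k * B))).
  by apply: lerD; rewrite ler_wpM2l ?(ltW s0)// sqr_ge0.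
have -> : (1 + rho) ^+ 2 * (A * (1 + rho) ^+ k * B) = A * (1 + rho) ^+ k.+2 * B.
  by rewrite !exprS; ring.
have q : (1 + rho) ^+ k.+1 <= (1 + rho) ^+ k.+2.
  by rewrite [leRHS]exprS ler_peMl ?exprn_ge0//; lra.
by have := ler_wpM2l (ltW (mulr_gt0 s0 A'0)) (ler_wpM2r B0 q); lra.
Qed.

(** The first bound has no decay but reaches back to t = -1 and supplies the majorants for
    differentiation; the other two give the decay. Here kappa = sigma / (4 (1 + sigma^2)): passing
    to the square root halves the rate of the energy, and rho^2 / (rho^2 + sigma^2) is at least
    rho^2 / (1 + sigma^2) for rho <= 1 and at least 1 / (1 + sigma^2) for rho >= 1. *)
Lemma dmult_bounds sigma (k : nat) : 0 < sigma -> exists A kappa, [/\ 0 < A, 0 < kappa,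
  forall rho t, 0 <= rho -> -1 <= t ->
    (1 + rho) * `|dmult sigma rho k t| <= A * (1 + rho) ^+ k,
  forall rho t, 0 <= rho -> rho <= 1 -> 0 <= t ->
    `|dmult sigma rho k t| <= A * expR (- (kappa * rho ^+ 2 * t)) &
  forall rho t, 1 <= rho -> 0 <= t ->
    (1 + rho) * `|dmult sigma rho k t| <= A * (1 + rho) ^+ k * expR (- (kappa * t))].
Proof.
move=> s0; have [A A0 hA] := dmult_le_energy k s0.
have p1 : 0 < 4 * (1 + sigma ^+ 2) by rewrite mulr_gt0// ltr_pwDl ?sqr_ge0.
have kap0 : 0 < sigma / (4 * (1 + sigma ^+ 2)) by rewrite divr_gt0.
have expD x t : expR (- (x * t / 2)) ^+ 2 = expR (- (x * t)).
  by rewrite -expRM_natl; congr expR; field.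
have decay rho t : 0 <= rho -> 0 <= t ->
   (1 + rho) * `|dmult sigma rho k t| <= A * (1 + rho) ^+ k *
   expR (- (sigma * rho ^+ 2 / (2 * (rho ^+ 2 + sigma ^+ 2)) * t / 2)).
  move=> r0 t0; apply: hA => //.
  by rewrite expD; exact: energy_decay.
(* Both regimes at once: x is rho^2 at low frequencies and 1 at high ones. *)
have aux rho x : x * (rho ^+ 2 + sigma ^+ 2) <= rho ^+ 2 * (1 + sigma ^+ 2) ->
    sigma / (4 * (1 + sigma ^+ 2)) * x <= sigma * rho ^+ 2 / (2 * (rho ^+ 2 + sigma ^+ 2)) / 2.
  move=> h; have q0 : 0 < rho ^+ 2 + sigma ^+ 2 by rewrite ltr_wpDl ?sqr_ge0 ?exprn_gt0.
  have p2 : 0 < 1 + sigma ^+ 2 by rewrite ltr_pwDl ?sqr_ge0.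
  rewrite -subr_ge0 (_ : _ - _ = sigma * (rho ^+ 2 * (1 + sigma ^+ 2) - x * (rho ^+ 2 + sigma ^+ 2))
    / (4 * (1 + sigma ^+ 2) * (rho ^+ 2 + sigma ^+ 2))); last first.
    by field; rewrite !gt_eqF.
  by rewrite divr_ge0// ?mulr_ge0 ?subr_ge0// ?(ltW s0) ?(ltW q0) ?(ltW p2).
have e1 : 1 <= expR sigma by rewrite -expR0 ler_expR ltW.
have A2 : A <= A * 2 ^+ k * expR sigma.
  rewrite -mulrA ler_peMr ?(ltW A0)// -[leLHS]mulr1; apply: ler_pM => //.
  by rewrite exprn_ege1// ler1n.
(* The factor 2^k absorbs (1 + rho)^k when rho <= 1, and e^sigma is the square root of the backward
   energy bound at t = -1. *)
exists (A * 2 ^+ k * expR sigma), (sigma / (4 * (1 + sigma ^+ 2))); split => //.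
- by rewrite !mulr_gt0 ?exprn_gt0 ?expR_gt0.
- move=> rho t r0 t1.
  have E : energy sigma rho t <= expR sigma ^+ 2.
    have [t0|t0] := leP 0 t.
      rewrite (le_trans (energy_decay rho s0 t0))// (@le_trans _ _ 1)//; last by rewrite exprn_ege1.
      rewrite expR_le1 oppr_le0 mulr_ge0// divr_ge0// ?mulr_ge0 ?addr_ge0 ?sqr_ge0 ?(ltW s0)//.
    rewrite (le_trans (energy_backward rho s0 (ltW t0)))// -expRM_natl ler_expR.
    by nra.
  have := hA _ _ _ r0 (expR_ge0 sigma) E.
  have X0 : 0 <= (1 + rho) ^+ k by rewrite exprn_ge0// addr_ge0.
  have k1 : 1 <= 2 ^+ k :> R by rewrite exprn_ege1// ler1n.
  move=> /le_trans; apply.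
  by have := ler_wpM2l (mulr_ge0 (mulr_ge0 (ltW A0) X0) (expR_ge0 sigma)) k1; lra.
- move=> rho t r0 r1 t0.
  apply: (@le_trans _ _ ((1 + rho) * `|dmult sigma rho k t|)).
    by rewrite ler_peMl//; lra.
  apply: (le_trans (decay _ _ r0 t0)); apply: ler_pM; rewrite ?expR_ge0 ?mulr_ge0 ?exprn_ge0 ?addr_ge0 ?(ltW A0)//.
    rewrite -mulrA ler_pM2l// -[leLHS]mulr1; apply: ler_pM => //; rewrite ?exprn_ge0 ?addr_ge0//.
    by apply: lerXn2r; rewrite ?nnegrE ?addr_ge0//; lra.
  rewrite ler_expR lerN2 (mulrAC _ t) ler_wpM2r//; apply: aux.
  by apply: ler_wpM2l; [exact: sqr_ge0|nra].
- move=> rho t r1 t0; have r0 : 0 <= rho by lra.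
  apply: (le_trans (decay _ _ r0 t0)); apply: ler_pM; rewrite ?expR_ge0 ?mulr_ge0 ?exprn_ge0 ?addr_ge0 ?(ltW A0)//.
    by rewrite ler_wpM2r ?exprn_ge0 ?addr_ge0.
  rewrite ler_expR lerN2 (mulrAC _ t) ler_wpM2r// -[leLHS]mulr1; apply: aux.
  have r2 : 1 <= rho ^+ 2 by rewrite exprn_ege1.
  by have := ler_wpM2r (sqr_ge0 sigma) r2; lra.
Qed.

End DampedOscillator.

(** * Identification and measurability of the multiplier *)

Section Multiplier.
Variable R : realType.
Implicit Types a t sigma rho : R.

Lemma multiplierE sigma t xi :
  multiplier sigma t xi = ((dmult sigma (dotR3 xi xi) 0 t)%:C)%C.
Proof.
rewrite /multiplier /= /osc_sin /csqrt.
set a := _ - _; have [a0|a0] := eqVneq a 0; first by rewrite mulrC.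
have [age0|alt0] := leP 0 a.
  have s0 : Num.sqrt a != 0 by rewrite gt_eqF// sqrtr_gt0 lt_neqAle eq_sym a0.
  move: (Num.sqrt a) s0 => s s0.
  apply/eqP; rewrite eq_complex /cexp /=; simpc; rewrite /= !(mulr0, mul0r, oppr0, cos0, sin0, subr0, addr0, mulr1).
  rewrite eqxx andbT; apply/eqP; by field.
have s0 : Num.sqrt (- a) != 0 by rewrite gt_eqF// sqrtr_gt0 oppr_gt0.
move: (Num.sqrt (- a)) s0 => s s0.
apply/eqP; rewrite eq_complex /cexp /=.
rewrite !(mul0r, mul1r, mulr0, mulr1, subr0, sub0r, add0r, addr0, oppr0, expR0, cosN, sinN, subrr, mulrN, expr0n).
apply/andP; split; apply/eqP; rewrite ?mul0r ?mulr0 ?subrr//; by field.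
Qed.

Lemma measurable_dmult sigma k t : measurable_fun setT (fun rho => dmult sigma rho k t).
Proof.
have ms : measurable_fun setT (@Num.sqrt R).
  by apply: continuous_measurable_fun; exact: sqrt_continuous.
have mN (f : R -> R) : measurable_fun setT f -> measurable_fun setT (fun x => - f x).
  by move=> mf; exact: measurableT_comp.
(* For nonnegative arguments the inverse is the real power -1, including the default value 0 at
   0. *)
have mV (f : R -> R) : measurable_fun setT f -> (forall x, 0 <= f x) ->
    measurable_fun setT (fun x => (f x)^-1).
  move=> mf f0; under eq_fun do rewrite -powR_inv1//.
  exact: (measurableT_comp (@measurable_powR R (-1)) mf).
have mc (g f : R -> R) : continuous g -> measurable_fun setT f -> measurable_fun setT (fun x => g (f x)).
  by move=> cg mf; apply: (measurableT_comp (continuous_measurable_fun cg) mf).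
have mth : measurable_fun setT (fun a => t / 2 * Num.sqrt a).
  by apply: measurable_funM.
have mthN : measurable_fun setT (fun a => t / 2 * Num.sqrt (- a)).
  by apply: measurable_funM => //; apply: mc; [exact: sqrt_continuous|exact: mN].
have m0 (f g h : R -> R) : measurable_fun setT f -> measurable_fun setT g -> measurable_fun setT h ->
    measurable_fun setT (fun a => if a == 0 then f a else if 0 <= a then g a else h a).
  move=> mf mg mh; apply: measurable_fun_ifT => //; first exact: measurable_fun_eqr.
  by apply: measurable_fun_ifT => //; exact: measurable_fun_ler.
have mS : measurable_fun setT (fun a => osc_sin a t).
  apply: m0 => //; apply: measurable_funM.
  - by apply: measurable_funB; apply: mc; do ?exact: continuous_expR; do ?exact: mN.
  - by apply: mV => // x; exact: sqrtr_ge0.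
  - by apply: measurable_funM => //; apply: mc => //; exact: continuous_sin.
  - by apply: mV => [|x]; [apply: mc; [exact: sqrt_continuous|exact: mN]|exact: sqrtr_ge0].
have mC : measurable_fun setT (fun a => osc_cos a t).
  apply: m0 => //; last by apply: mc => //; exact: continuous_cos.
  apply: measurable_funM => //.
  by apply: measurable_funD; apply: mc; do ?exact: continuous_expR; do ?exact: mN.
have ma : measurable_fun setT (fun rho => sigma ^+ 2 - 4 * rho ^+ 2).
  by apply: measurable_funB => //; apply: measurable_funM => //; exact: measurable_funX.
have mS2 := measurableT_comp mS ma; have mC2 := measurableT_comp mC ma.
suff : measurable_fun setT (fun rho => dmult sigma rho k t) /\
  measurable_fun setT (fun rho => dmult sigma rho k.+1 t) by case.
elim: k => [|k [ih1 ih2]].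
  split; apply: measurable_funM => //; apply: measurable_funB => //.
  exact: measurable_funM.
split => //; apply: measurable_funB; exact: measurable_funM.
Qed.

End Multiplier.

(** * Integrals over R^3 *)

(** The library's sigma-finite instance for products is shadowed by the one for
    products of subprobabilities; this alias restores it. *)
Section SigmaFiniteProduct.
Context d1 d2 (T1 : measurableType d1) (T2 : measurableType d2) (R : realType).
Variable m1 : {sigma_finite_measure set T1 -> \bar R}.
Variable m2 : {sigma_finite_measure set T2 -> \bar R}.

Definition sf_prod : set (T1 * T2) -> \bar R := (m1 \x m2)%E.

HB.instance Definition _ := Measure.on sf_prod.

Lemma sf_prod_sigma_finite : sigma_finite setT sf_prod.
Proof.
have /sigma_finiteP[F [TF ndF Foo]] := sigma_finiteT m1.
have /sigma_finiteP[G [TG ndG Goo]] := sigma_finiteT m2.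
exists (fun n => F n `*` G n) => [|n]; last first.
  have [mF Fn] := Foo n; have [mG Gn] := Goo n; split; first exact: measurableX.
  by rewrite /sf_prod product_measure1E// lte_mul_pinfty// ge0_fin_numE.
apply/seteqP; split => // -[x y] _.
have [i _ Fx] : (\bigcup_n F n) x by rewrite -TF.
have [j _ Gy] : (\bigcup_n G n) y by rewrite -TG.
exists (maxn i j) => //; split.
  by have /subsetPset := ndF _ _ (leq_maxl i j); exact.
by have /subsetPset := ndG _ _ (leq_maxr i j); exact.
Qed.

HB.instance Definition _ := Measure_isSigmaFinite.Build _ _ _ sf_prod
  sf_prod_sigma_finite.

End SigmaFiniteProduct.

Section ProductIntegrals.
Variable R : realType.
Let leb := @lebesgue_measure R.

Lemma measurable_dotR3 d (T : measurableType d) (f g : T -> R3 R) :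
  measurable_fun setT f -> measurable_fun setT g ->
  measurable_fun setT (fun x => dotR3 (f x) (g x)).
Proof.
move=> mf mg; rewrite /dotR3.
have f1 := measurableT_comp measurable_fst mf; have g1 := measurableT_comp measurable_fst mg.
have f2 := measurableT_comp measurable_snd mf; have g2 := measurableT_comp measurable_snd mg.
have f11 := measurableT_comp measurable_fst f1; have g11 := measurableT_comp measurable_fst g1.
have f12 := measurableT_comp measurable_snd f1; have g12 := measurableT_comp measurable_snd g1.
by apply: measurable_funD; [apply: measurable_funD|]; apply: measurable_funM.
Qed.

Lemma ge0_integral_prod_sep d1 d2 (T1 : measurableType d1) (T2 : measurableType d2)
    (m1 : {sigma_finite_measure set T1 -> \bar R})
    (m2 : {sigma_finite_measure set T2 -> \bar R}) (g1 : T1 -> R) (g2 : T2 -> R) :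
  measurable_fun setT g1 -> measurable_fun setT g2 ->
  (forall x, 0 <= g1 x) -> (forall x, 0 <= g2 x) ->
  (\int[m1 \x m2]_x (g1 x.1 * g2 x.2)%:E =
   (\int[m1]_x (g1 x)%:E) * (\int[m2]_x (g2 x)%:E))%E.
Proof.
move=> mg1 mg2 p1 p2.
rewrite fubini_tonelli1 /fubini_F /=; last 2 first.
- apply/measurable_EFinP; apply: measurable_funM.
    exact: (measurableT_comp mg1 measurable_fst).
  exact: (measurableT_comp mg2 measurable_snd).
- by move=> x; rewrite lee_fin mulr_ge0.
transitivity (\int[m1]_x ((g1 x)%:E * \int[m2]_y (g2 y)%:E))%E.
  apply: eq_integral => x _; under eq_integral do rewrite EFinM.
  rewrite ge0_integralZl ?lee_fin//; first exact/measurable_EFinP.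
  by move=> y _; rewrite lee_fin.
rewrite ge0_integralZr//; first exact/measurable_EFinP.
- by move=> x _; rewrite lee_fin.
- by apply: integral_ge0 => x _; rewrite lee_fin.
Qed.

Lemma ge0_integral3_sep (g1 g2 g3 : R -> R) :
  measurable_fun setT g1 -> measurable_fun setT g2 -> measurable_fun setT g3 ->
  (forall x, 0 <= g1 x) -> (forall x, 0 <= g2 x) -> (forall x, 0 <= g3 x) ->
  (\int[leb3 R]_x (g1 x.1.1 * g2 x.1.2 * g3 x.2)%:E =
   (\int[leb]_x (g1 x)%:E) * (\int[leb]_x (g2 x)%:E) * (\int[leb]_x (g3 x)%:E))%E.
Proof.
move=> m1 m2 m3 p1 p2 p3.
rewrite (@ge0_integral_prod_sep _ _ _ _ (sf_prod leb leb) leb (fun x => g1 x.1 * g2 x.2) g3) //.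
- by rewrite ge0_integral_prod_sep.
- apply: measurable_funM.
    exact: (measurableT_comp m1 measurable_fst).
  exact: (measurableT_comp m2 measurable_snd).
- by move=> x; rewrite mulr_ge0.
Qed.

Lemma dotR3_ge0 (x : R3 R) : 0 <= dotR3 x x.
Proof. by rewrite /dotR3 -!expr2 !addr_ge0 ?sqr_ge0. Qed.

Lemma measurable_sqnorm : measurable_fun setT (fun xi : R3 R => dotR3 xi xi).
Proof. exact: measurable_dotR3. Qed.

Lemma measurable_japanese (q : R) :
  measurable_fun setT (fun xi : R3 R => (1 + dotR3 xi xi) `^ q).
Proof.
apply: (measurableT_comp (@measurable_powR R q)).
by apply: measurable_funD => //; exact: measurable_sqnorm.
Qed.

(** With p = q / 3 < 0, the integrand is a product of three powers (1 + |xi|^2)^p, each at most (1 +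
    xi_i^2)^p. The threshold -3/2 is exactly three times the one-dimensional threshold -1/2, so this
    crude splitting loses nothing. *)
Lemma integral3_japanese_lty (q : R) : q < - (3 / 2) ->
  (\int[leb3 R]_xi ((1 + dotR3 xi xi) `^ q)%:E < +oo)%E.
Proof.
move=> q32; pose p := q / 3; pose g (x : R) := (1 + x ^+ 2) `^ p.
have mg : measurable_fun setT g.
  apply: (measurableT_comp (@measurable_powR R _)).
  by apply: measurable_funD => //; exact: measurable_funX.
have g0 x : 0 <= g x by exact: powR_ge0.
apply: (@le_lt_trans _ _ (\int[leb3 R]_xi (g xi.1.1 * g xi.1.2 * g xi.2)%:E)%E).
  apply: ge0_le_integral => //.
  - by move=> xi _; rewrite lee_fin powR_ge0.
  - by apply/measurable_EFinP; exact: measurable_japanese.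
  - apply/measurable_EFinP; apply: measurable_funM; [apply: measurable_funM|].
    + exact: (measurableT_comp mg (measurableT_comp measurable_fst measurable_fst)).
    + exact: (measurableT_comp mg (measurableT_comp measurable_snd measurable_fst)).
    + exact: (measurableT_comp mg measurable_snd).
  move=> [[x y] z] _; rewrite lee_fin /g /dotR3/= -!expr2.
  set r := _ + _ + z ^+ 2.
  have -> : q = p * 3 by rewrite /p; field.
  rewrite powRrM powR_mulrn ?powR_ge0// 2!exprS expr1 mulrA.
  have r0 : 0 < 1 + r by rewrite ltr_pwDl// /r !addr_ge0 ?sqr_ge0.
  have H (u : R) : u ^+ 2 <= r -> (1 + r) `^ p <= (1 + u ^+ 2) `^ p.
    move=> ur; have u0 : 0 < 1 + u ^+ 2 by rewrite ltr_pwDl ?sqr_ge0.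
    rewrite -[p]opprK !(powRN _ (- p)) lef_pV2 ?posrE ?powR_gt0// ge0_ler_powR ?nnegrE ?(ltW r0) ?(ltW u0)//.
      by rewrite /p; lra.
    by rewrite lerD2l.
  have [[x2 y2] z2] := (sqr_ge0 x, sqr_ge0 y, sqr_ge0 z).
  have hx := H x; have hy := H y; have hz := H z.
  have h0 (u : R) : 0 <= u `^ p by exact: powR_ge0.
  apply: ler_pM; [exact: mulr_ge0|exact: h0| |by apply: hz; rewrite /r; lra].
  apply: ler_pM; [exact: h0|exact: h0|by apply: hx; rewrite /r; lra|by apply: hy; rewrite /r; lra].
rewrite ge0_integral3_sep//.
have h : (\int[leb]_x (g x)%:E < +oo)%E 
  by rewrite /g -[p]opprK; apply: integralT_japanese_lty; rewrite /p; lra.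
have h0 : (0 <= \int[leb]_x (g x)%:E)%E by apply: integral_ge0 => x _; rewrite lee_fin.
have hf : (\int[leb]_x (g x)%:E)%E \is a fin_num by rewrite ge0_fin_numE.
by case: (\int[leb]_x (g x)%:E)%E hf => // r _; rewrite -!EFinM ltry.
Qed.

End ProductIntegrals.

(** * Majorant at low frequencies *)

Section LowFrequency.
Variable R : realType.
Let leb := @lebesgue_measure R.

(** Take N-th roots: 1 + y <= 2 (1 + y^4), and 1 + k' y^4 <= e^(k' y^4) with k' = k / N. Only N = 0
    has to be set apart. *)
Lemma polynomial_le_expR (k : R) (N : nat) : 0 < k -> exists2 C, 0 < C &
  forall y, 0 <= y -> (1 + y) ^+ N <= C * expR (k * y ^+ 4).
Proof.
move=> k0; case: N => [|N'].
  exists 1 => // y y0; rewrite expr0 mul1r -expR0 ler_expR.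
  by rewrite mulr_ge0 ?exprn_ge0 ?(ltW k0).
set N := N'.+1; have N0 : 0 < N%:R :> R by rewrite ltr0n.
pose k' := k / N%:R; have k'0 : 0 < k' by rewrite divr_gt0.
exists ((2 * (1 + k'^-1)) ^+ N); first by rewrite exprn_gt0// mulr_gt0// addr_gt0// invr_gt0.
move=> y y0.
have -> : k * y ^+ 4 = N%:R * (k' * y ^+ 4) by rewrite /k'; field; rewrite gt_eqF.
have c0 : 0 <= 1 + k'^-1 by rewrite addr_ge0 ?invr_ge0 ?(ltW k'0).
rewrite expRM_natl -exprMn; apply: lerXn2r; rewrite ?nnegrE ?addr_ge0//.
  by rewrite !mulr_ge0 ?expR_ge0.
apply: (@le_trans _ _ (2 * (1 + y ^+ 4))); first by have := sqr_ge0 (1 - y); have := sqr_ge0 (1 - y ^+ 2); nra.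
rewrite -mulrA ler_pM2l//.
have e := expR_ge1Dx (k' * y ^+ 4).
have y4 : 0 <= y ^+ 4 by rewrite exprn_ge0.
apply: (@le_trans _ _ ((1 + k'^-1) * (1 + k' * y ^+ 4))).
  rewrite (_ : (1 + k'^-1) * _ = 1 + y ^+ 4 + (k'^-1 + k' * y ^+ 4)); last by field; rewrite gt_eqF.
  rewrite lerDl; apply: addr_ge0; first by rewrite invr_ge0 ltW.
  exact: mulr_ge0 (ltW k'0) y4.
by rewrite ler_wpM2l// addr_ge0// invr_ge0 ltW.
Qed.

(** With r = |xi| and a = (1 + t)^(1/4), the left side is a^(-n) times a quantity bounded by C e^k
    (1 + a r)^(-6). This power splits into three factors (1 + a r)^(-2) <= 1 / (1 + (a xi_i)^2). The
    product of these is a^(-3) times three Poisson kernels of mass pi, so a^(-n-3) is exactly the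
    required power of 1 + t. *)
Lemma low_frequency_bound (n : nat) (k : R) : 0 < k -> exists2 C, 0 < C &
  forall t, 0 <= t -> exists g : R3 R -> R,
  [/\ measurable_fun setT g, forall xi, 0 <= g xi,
    (\int[leb3 R]_xi (g xi)%:E = (C * (1 + t) `^ (- ((3 + n)%:R / 4)))%:E)%E &
    forall xi, dotR3 xi xi <= 1 ->
      Num.sqrt (dotR3 xi xi) ^+ n * expR (- (k * dotR3 xi xi ^+ 2 * t)) <= g xi].
Proof.
move=> k0; have [C C0 hC] := polynomial_le_expR (n + 6) k0.
exists (C * expR k * pi ^+ 3); first by rewrite !mulr_gt0 ?expR_gt0 ?exprn_gt0 ?pi_gt0.
move=> t t0.
have T0 : 0 < 1 + t by rewrite ltr_pwDl.
pose a := (1 + t) `^ (1 / 4); have a0 : 0 < a by exact: powR_gt0.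
have a4 : a ^+ 4 = 1 + t.
  by rewrite -powR_mulrn ?(ltW a0)// -powRrM (_ : 1 / 4 * 4%:R = 1) ?powRr1 ?(ltW T0)//; field.
pose p (y : R) := a / (1 + (a * (y - 0)) ^+ 2).
have den y : 0 < 1 + (a * (y - 0)) ^+ 2 by rewrite ltr_pwDl ?sqr_ge0.
have p0 y : 0 <= p y by rewrite divr_ge0 ?(ltW a0) ?(ltW (den y)).
have mp : measurable_fun setT p.
  apply: continuous_measurable_fun => y; apply: cvgM; first exact: cvg_cst.
  apply: cvgV; first by rewrite gt_eqF.
  apply: cvgD; first exact: cvg_cst.
  apply: (@cvg_comp _ _ _ (fun y : R => a * (y - 0)) (fun u => u ^+ 2)); last exact: exprn_continuous.
  by apply: cvgM; [exact: cvg_cst|apply: cvgB; [exact: cvg_id|exact: cvg_cst]].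
pose K := C * expR k * a ^- (n + 3).
have K0 : 0 <= K by rewrite !mulr_ge0 ?invr_ge0 ?exprn_ge0 ?expR_ge0 ?(ltW C0) ?(ltW a0).
have mg : measurable_fun setT (fun xi : R3 R => p xi.1.1 * p xi.1.2 * p xi.2).
  apply: measurable_funM; [apply: measurable_funM|].
  - exact: (measurableT_comp mp (measurableT_comp measurable_fst measurable_fst)).
  - exact: (measurableT_comp mp (measurableT_comp measurable_snd measurable_fst)).
  - exact: (measurableT_comp mp measurable_snd).
have g0 (xi : R3 R) : 0 <= p xi.1.1 * p xi.1.2 * p xi.2.
  by rewrite mulr_ge0// mulr_ge0.
exists (fun xi => K * (p xi.1.1 * p xi.1.2 * p xi.2)); split.
- exact: measurable_funM.
- by move=> xi; exact: mulr_ge0.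
- under eq_integral do rewrite EFinM.
  rewrite ge0_integralZl//; last 2 first.
  + exact/measurable_EFinP.
  + by move=> xi _; rewrite lee_fin.
  rewrite ge0_integral3_sep// integralT_poisson// -!EFinM; congr (_%:E).
  have -> : (1 + t) `^ (- ((3 + n)%:R / 4)) = a ^- (n + 3).
    by rewrite -powR_mulrn ?(ltW a0)// -powRN -powRrM addnC mul1r mulrN mulrC.
  by rewrite /K; ring.
move=> xi rho1.
set r := Num.sqrt _; set rho := dotR3 xi xi in rho1 r *.
have r0 : 0 <= r by exact: sqrtr_ge0.
have r2 : r ^+ 2 = rho by rewrite sqr_sqrtr// dotR3_ge0.
have b (u : R) : u ^+ 2 <= rho -> a / (1 + a * r) ^+ 2 <= p u.
  move=> ur; rewrite /p subr0 ler_pM2l// lef_pV2 ?posrE ?exprn_gt0 ?ltr_pwDl ?sqr_ge0 ?mulr_ge0 ?(ltW a0)//.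
  rewrite exprMn; have := mulr_ge0 (ltW a0) r0; have := ler_wpM2l (sqr_ge0 a) ur.
  by rewrite -r2; lra.
have q0 : 0 < 1 + a * r by rewrite ltr_pwDl// mulr_ge0// ltW.
apply: (@le_trans _ _ (K * (a / (1 + a * r) ^+ 2) ^+ 3)); last first.
  have h0 : 0 <= a / (1 + a * r) ^+ 2 by rewrite divr_ge0 ?exprn_ge0 ?(ltW a0) ?(ltW q0).
  have [[x2 y2] z2] := (sqr_ge0 xi.1.1, sqr_ge0 xi.1.2, sqr_ge0 xi.2).
  have E : rho = xi.1.1 ^+ 2 + xi.1.2 ^+ 2 + xi.2 ^+ 2 by [].
  rewrite ler_wpM2l// 2!exprS expr1 mulrA.
  apply: ler_pM; [exact: mulr_ge0|exact: h0| |by apply: b; rewrite E; lra].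
  by apply: ler_pM; [exact: h0|exact: h0|by apply: b; rewrite E; lra|by apply: b; rewrite E; lra].
have H := hC (a * r) (mulr_ge0 (ltW a0) r0).
rewrite exprMn a4 (_ : r ^+ 4 = rho ^+ 2) in H; last by rewrite -r2 -exprM.
have -> : K * (a / (1 + a * r) ^+ 2) ^+ 3 =
    C * expR k * (a ^+ n)^-1 * ((1 + a * r) ^+ 6)^-1.
  by rewrite /K exprD; field; rewrite ?expf_neq0 ?gt_eqF.
(* Replacing t by 1 + t, which makes the scale a appear, costs e^(k rho^2) <= e^k because rho <=
   1. *)
have -> : expR (- (k * rho ^+ 2 * t)) = expR (k * rho ^+ 2) * expR (- (k * ((1 + t) * rho ^+ 2))).
  by rewrite -expRD; congr expR; ring.
have -> : r ^+ n = (a * r) ^+ n / a ^+ n.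
  by rewrite exprMn mulrAC divff ?mul1r// expf_neq0// gt_eqF.
have e1 : expR (k * rho ^+ 2) <= expR k.
  rewrite ler_expR -[leRHS]mulr1 ler_pM2l// exprn_ile1// dotR3_ge0//.
have e2 : (a * r) ^+ n * expR (- (k * ((1 + t) * rho ^+ 2))) <= C / (1 + a * r) ^+ 6.
  rewrite expRN ler_pdivrMr ?expR_gt0// mulrAC ler_pdivlMr ?exprn_gt0//.
  apply: le_trans H; rewrite exprD ler_wpM2r ?exprn_ge0 ?(ltW q0)//.
  by apply: lerXn2r; rewrite ?nnegrE ?(ltW q0) ?mulr_ge0 ?(ltW a0)// lerDr.
have E3 : 0 <= (a * r) ^+ n * expR (- (k * ((1 + t) * rho ^+ 2))).
  by rewrite mulr_ge0 ?expR_ge0// exprn_ge0// mulr_ge0// ltW.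
have := ler_pM (expR_ge0 _) E3 e1 e2.
have an : 0 <= (a ^+ n)^-1 by rewrite invr_ge0 exprn_ge0// ltW.
by move=> /(ler_wpM2l an); lra.
Qed.

End LowFrequency.

(** * Fourier integrals *)

Section InverseFourier.
Variable R : realType.
Local Notation normc := (@ComplexField.Normc.normc R).
Local Notation Re := (@complex.Re R).
Local Notation Im := (@complex.Im R).
Local Notation mu := (leb3 R).

Lemma normc_ge0 (z : R[i]) : 0 <= normc z.
Proof. by case: z => a b; exact: sqrtr_ge0. Qed.

Lemma normr_Re_le (z : R[i]) : `|Re z| <= normc z.
Proof. by case: z => a b /=; rewrite -sqrtr_sqr ler_sqrt ?addr_ge0 ?sqr_ge0// lerDl sqr_ge0. Qed.

Lemma normr_Im_le (z : R[i]) : `|Im z| <= normc z.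
Proof. by case: z => a b /=; rewrite -sqrtr_sqr ler_sqrt ?addr_ge0 ?sqr_ge0// lerDr sqr_ge0. Qed.

Lemma normc_le_ReIm (z : R[i]) : normc z <= `|Re z| + `|Im z|.
Proof.
case: z => a b /=; rewrite -[leRHS]ger0_norm ?addr_ge0// -sqrtr_sqr ler_sqrt ?sqr_ge0//.
rewrite -(real_normK (num_real a)) -(real_normK (num_real b)).
by have := mulr_ge0 (normr_ge0 a) (normr_ge0 b); lra.
Qed.

Lemma normc_real (r : R) : normc (r%:C)%C = `|r|.
Proof. by rewrite /= expr0n /= addr0 sqrtr_sqr. Qed.

Lemma normc_i : normc 'i%C = 1.
Proof. by rewrite /= expr0n /= add0r expr1n sqrtr1. Qed.

Lemma cexp_i (r : R) : cexp ('i * r%:C)%C = Complex (cos r) (sin r).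
Proof. by rewrite /cexp /= !(mul0r, mulr0, mul1r, subr0, add0r, addr0, oppr0, expR0). Qed.

Lemma inv_fourierE (p : R3 R -> R[i]) (x : R3 R) : inv_fourier p x =
  Complex (\int[mu]_xi (cos (dotR3 x xi) * Re (p xi) - sin (dotR3 x xi) * Im (p xi)))
          (\int[mu]_xi (cos (dotR3 x xi) * Im (p xi) + sin (dotR3 x xi) * Re (p xi))).
Proof.
by rewrite /inv_fourier /Cintegral; congr Complex; apply: eq_Rintegral => xi _;
  rewrite cexp_i; case: (p xi).
Qed.

Lemma measurable_normc (p : R3 R -> R[i]) : cmeasurable p ->
  measurable_fun setT (fun xi => normc (p xi)).
Proof.
move=> [mr mi].
have -> : (fun xi => normc (p xi)) = (@Num.sqrt R) \o (fun xi => Re (p xi) ^+ 2 + Im (p xi) ^+ 2).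
  by apply/funext => xi /=; case: (p xi).
apply: measurableT_comp.
  by apply: continuous_measurable_fun; exact: sqrt_continuous.
by apply: measurable_funD; exact: measurable_funX.
Qed.

Definition cintegrable (p : R3 R -> R[i]) :=
  cmeasurable p /\ mu.-integrable setT (EFin \o (fun xi => normc (p xi))).

Lemma integrable_dom (f g : R3 R -> R) : measurable_fun setT f ->
  mu.-integrable setT (EFin \o g) -> (forall xi, `|f xi| <= g xi) ->
  mu.-integrable setT (EFin \o f).
Proof.
move=> mf ig fg; apply: (le_integrable measurableT _ _ ig); first exact/measurable_EFinP.
by move=> xi _ /=; rewrite lee_fin (le_trans (fg xi))// ler_norm.
Qed.

Lemma measurable_cos_dot (x : R3 R) : measurable_fun setT (fun xi => cos (dotR3 x xi)).
Proof.
apply: (measurableT_comp (continuous_measurable_fun (@continuous_cos R))).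
exact: measurable_dotR3.
Qed.

Lemma measurable_sin_dot (x : R3 R) : measurable_fun setT (fun xi => sin (dotR3 x xi)).
Proof.
apply: (measurableT_comp (continuous_measurable_fun (@continuous_sin R))).
exact: measurable_dotR3.
Qed.

Lemma normr_cos_le (r : R) : `|cos r| <= 1.
Proof. by rewrite ler_norml cos_geN1 cos_le1. Qed.

Lemma normr_sin_le (r : R) : `|sin r| <= 1.
Proof. by rewrite ler_norml sin_geN1 sin_le1. Qed.

Lemma normr_rot_le (r a b : R) : `|cos r * a - sin r * b| <= `|a| + `|b|.
Proof.
rewrite (le_trans (ler_normB _ _))// !normrM.
by apply: lerD; rewrite ler_piMl// ?normr_cos_le ?normr_sin_le.
Qed.

Lemma normr_rotD_le (r a b : R) : `|cos r * a + sin r * b| <= `|a| + `|b|.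
Proof.
rewrite (le_trans (ler_normD _ _))// !normrM.
by apply: lerD; rewrite ler_piMl// ?normr_cos_le ?normr_sin_le.
Qed.

Lemma cintegrable_Re (p : R3 R -> R[i]) : cintegrable p -> mu.-integrable setT (EFin \o (fun xi => Re (p xi))).
Proof. by move=> [[mr mi] ip]; apply: integrable_dom ip _ => // xi; exact: normr_Re_le. Qed.

Lemma cintegrable_Im (p : R3 R -> R[i]) : cintegrable p -> mu.-integrable setT (EFin \o (fun xi => Im (p xi))).
Proof. by move=> [[mr mi] ip]; apply: integrable_dom ip _ => // xi; exact: normr_Im_le. Qed.

Lemma integrable_rot (x : R3 R) (a b : R3 R -> R) :
  mu.-integrable setT (EFin \o a) -> mu.-integrable setT (EFin \o b) ->
  mu.-integrable setT (EFin \o (fun xi => cos (dotR3 x xi) * a xi - sin (dotR3 x xi) * b xi)) /\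
  mu.-integrable setT (EFin \o (fun xi => cos (dotR3 x xi) * a xi + sin (dotR3 x xi) * b xi)).
Proof.
move=> ia ib.
have /integrableP[/measurable_EFinP ma _] := ia; have /integrableP[/measurable_EFinP mb _] := ib.
have mc := measurable_cos_dot x; have ms := measurable_sin_dot x.
have iab : mu.-integrable setT (EFin \o (fun xi => `|a xi| + `|b xi|)).
  have -> : EFin \o (fun xi => `|a xi| + `|b xi|) = (abse \o (EFin \o a)) \+ (abse \o (EFin \o b)) by [].
  by apply: integrableD => //; exact: integrable_abse.
split; apply: integrable_dom iab _.
- by apply: measurable_funB; exact: measurable_funM.
- by move=> xi; exact: normr_rot_le.
- by apply: measurable_funD; exact: measurable_funM.
- by move=> xi; exact: normr_rotD_le.
Qed.

(** The constant is 4 because the real and imaginary parts of the integral are each bounded by the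
    integral of |Re p| + |Im p|. *)
Lemma normc_inv_fourier_le (p : R3 R -> R[i]) (x : R3 R) : cintegrable p ->
  ((normc (inv_fourier p x))%:E <= 4%:E * \int[mu]_xi (normc (p xi))%:E)%E.
Proof.
move=> ip; have [[mr mi] ipn] := ip.
have [ir ii] := (cintegrable_Re ip, cintegrable_Im ip).
have i1 := (integrable_rot x ir ii).1; have i2 := (integrable_rot x ii ir).2.
have N : (\int[mu]_xi (normc (p xi))%:E)%E = (\int[mu]_xi normc (p xi))%:E.
  by rewrite /Rintegral fineK//; exact: (integrable_fin_num _ ipn).
rewrite N -EFinM lee_fin.
have half (f : R3 R -> R) : mu.-integrable setT (EFin \o f) ->
    (forall xi, `|f xi| <= 2 * normc (p xi)) -> `|\int[mu]_xi f xi| <= 2 * \int[mu]_xi normc (p xi).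
  move=> jf fp; rewrite (le_trans (le_normr_Rintegral _ jf))//.
  rewrite -RintegralZl//; apply: le_Rintegral => //.
    exact: (integrable_abse jf).
  have -> : EFin \o (fun xi => 2 * normc (p xi)) = (fun xi => 2%:E * (EFin \o (fun xi => normc (p xi))) xi)%E by [].
  exact: integrableZl.
rewrite (le_trans (normc_le_ReIm _))// inv_fourierE/=.
have -> : 4 * \int[mu]_xi normc (p xi) = 2 * \int[mu]_xi normc (p xi) + 2 * \int[mu]_xi normc (p xi) by ring.
apply: lerD; apply: half => // xi.
  by rewrite (le_trans (normr_rot_le _ _ _))// mulrDl mul1r lerD ?normr_Re_le ?normr_Im_le.
by rewrite (le_trans (normr_rotD_le _ _ _))// mulrDl mul1r lerD ?normr_Re_le ?normr_Im_le.
Qed.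

Lemma cvg_diff_quotient_integral (f df : R -> R3 R -> R) (G : R3 R -> R) (u v a : R) :
  u < a < v ->
  (forall x, u < x < v -> mu.-integrable setT (EFin \o f x)) ->
  (forall x y, u < x < v -> is_derive x 1 (f ^~ y) (df x y)) ->
  mu.-integrable setT (EFin \o G) ->
  (forall x y, u < x < v -> `|df x y| <= G y) ->
  h^-1 *: (\int[mu]_y f (h + a) y - \int[mu]_y f a y) @[h --> 0^'] --> \int[mu]_y df a y.
Proof.
move=> auv intf fdf iG dfG.
have d1 x y : u < x < v -> partial1of2 f x y = df x y.
  by move=> xuv; rewrite partial1of2E; have [_ ->] := fdf x y xuv.
have G0 y : 0 <= G y by exact: le_trans (normr_ge0 _) (dfG a y auv).
have -> : \int[mu]_y df a y = \int[mu]_y partial1of2 f a y.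
  by apply: eq_Rintegral => y _; rewrite d1.
apply: (@cvg_differentiation_under_integral _ _ _ mu f setT measurableT a u v _ _ _ G) => //.
- by move=> x y; rewrite /= ?in_itv /= => xuv _; have [] := fdf x y xuv.
- by move=> x y; rewrite /= ?in_itv /= => xuv _; rewrite d1// dfG.
Qed.

Lemma is_derive_line (f : R3 R -> R) (x e : R3 R) (l : R) :
  h^-1 *: (f (h *: e + x) - f x) @[h --> 0^'] --> l -> is_derive x e f l.
Proof.
by move=> fl; apply: DeriveDef; [apply: cvgP fl|exact: cvg_lim fl].
Qed.

Lemma dotR3_line (h : R) (e x xi : R3 R) :
  dotR3 (h *: e + x) xi = h * dotR3 e xi + dotR3 x xi.
Proof. by rewrite /dotR3 /= /GRing.scale/=; ring. Qed.

Lemma cintegrableM (a : R3 R -> R) (p : R3 R -> R[i]) : measurable_fun setT a ->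
  cmeasurable p -> cmeasurable (fun xi => 'i%C * ((a xi)%:C)%C * p xi).
Proof.
move=> ma [mr mi]; split.
  have -> : (fun xi => Re ('i%C * ((a xi)%:C)%C * p xi)) = (fun xi => - (a xi * Im (p xi))).
    by apply/funext => xi; case: (p xi) => u v /=; ring.
  by apply: (measurableT_comp (@oppr_measurable R setT)); exact: measurable_funM.
have -> : (fun xi => Im ('i%C * ((a xi)%:C)%C * p xi)) = (fun xi => (a xi * Re (p xi))).
  by apply/funext => xi; case: (p xi) => u v /=; ring.
exact: measurable_funM.
Qed.

(** On the line x + h e the phase is affine in h with slope e . xi, so the h-derivative of each
    integrand is dominated by twice the modulus of the new symbol, uniformly in h. The interval ]-1,
    1[ is an arbitrary neighbourhood of h = 0. *)
Lemma is_derive_inv_fourier (e x : R3 R) (p : R3 R -> R[i]) :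
  cintegrable p -> cintegrable (fun xi => 'i%C * ((dotR3 e xi)%:C)%C * p xi) ->
  is_derive x e (fun y => Re (inv_fourier p y))
    (Re (inv_fourier (fun xi => 'i%C * ((dotR3 e xi)%:C)%C * p xi) x)) /\
  is_derive x e (fun y => Im (inv_fourier p y))
    (Im (inv_fourier (fun xi => 'i%C * ((dotR3 e xi)%:C)%C * p xi) x)).
Proof.
move=> ip iq.
have [ir ii] := (cintegrable_Re ip, cintegrable_Im ip).
pose q xi := Complex (- (dotR3 e xi * Im (p xi))) (dotR3 e xi * Re (p xi)).
have qE : (fun xi => 'i%C * ((dotR3 e xi)%:C)%C * p xi) = q.
  apply/funext => xi; rewrite /q; case: (p xi) => u v.
  by apply/eqP; rewrite eq_complex /=; apply/andP; split; apply/eqP; ring.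
rewrite qE in iq *.
pose G xi := normc (q xi) + normc (q xi).
have iG : mu.-integrable setT (EFin \o G) by have [_ j] := iq; exact: (integrableD _ j j).
have e0 : -1 < (0 : R) < 1 by rewrite ltrN10 ltr01.
split.
  apply: is_derive_line.
  pose f h xi := cos (dotR3 (h *: e + x) xi) * Re (p xi) - sin (dotR3 (h *: e + x) xi) * Im (p xi).
  pose df h xi := cos (dotR3 (h *: e + x) xi) * Re (q xi) -
                  sin (dotR3 (h *: e + x) xi) * Im (q xi).
  rewrite [X in _ --> X](_ : _ = \int[mu]_xi df 0 xi); last first.
    by rewrite (inv_fourierE q) /df scale0r add0r.
  rewrite [X in X @ _ --> _](_ : _ = fun h : R => h^-1 *: (\int[mu]_xi f (h + 0) xi - \int[mu]_xi f 0 xi)); last first.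
    by apply/funext => h; rewrite !inv_fourierE /f addr0 scale0r add0r.
  apply: (@cvg_diff_quotient_integral f df G (-1) 1 0 e0 _ _ iG _).
  - by move=> h _; exact: (integrable_rot _ ir ii).1.
  - move=> h xi _; rewrite /f; under eq_fun do rewrite dotR3_line.
    by apply: is_derive_eq; rewrite /df dotR3_line /GRing.scale /=; ring.
  - move=> h xi _; rewrite /G (le_trans (normr_rot_le _ _ _))// lerD//.
      exact: (normr_Re_le (q xi)).
    exact: (normr_Im_le (q xi)).
apply: is_derive_line.
pose f h xi := cos (dotR3 (h *: e + x) xi) * Im (p xi) + sin (dotR3 (h *: e + x) xi) * Re (p xi).
pose df h xi := cos (dotR3 (h *: e + x) xi) * Im (q xi) +
                sin (dotR3 (h *: e + x) xi) * Re (q xi).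
rewrite [X in _ --> X](_ : _ = \int[mu]_xi df 0 xi); last first.
  by rewrite (inv_fourierE q) /df scale0r add0r.
rewrite [X in X @ _ --> _](_ : _ = fun h : R => h^-1 *: (\int[mu]_xi f (h + 0) xi - \int[mu]_xi f 0 xi)); last first.
  by apply/funext => h; rewrite !inv_fourierE /f addr0 scale0r add0r.
apply: (@cvg_diff_quotient_integral f df G (-1) 1 0 e0 _ _ iG _).
- by move=> h _; exact: (integrable_rot _ ii ir).2.
- move=> h xi _; rewrite /f; under eq_fun do rewrite dotR3_line.
  by apply: is_derive_eq; rewrite /df dotR3_line /GRing.scale /=; ring.
- move=> h xi _; rewrite /G (le_trans (normr_rotD_le _ _ _))// lerD//.
    exact: (normr_Im_le (q xi)).
  exact: (normr_Re_le (q xi)).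
Qed.

End InverseFourier.

(** * Plancherel inequality *)

Section FubiniReal.
Context d1 d2 (T1 : measurableType d1) (T2 : measurableType d2) (R : realType).
Variable m1 : {sigma_finite_measure set T1 -> \bar R}.
Variable m2 : {sigma_finite_measure set T2 -> \bar R}.

Lemma measurable_Rintegral_snd (h : T1 * T2 -> R) : measurable_fun setT h ->
  measurable_fun setT (fun x => \int[m2]_y h (x, y)).
Proof.
move=> /measurable_EFinP mh.
apply: (measurableT_comp (@fine_measurable R setT measurableT)).
have -> : (fun x => \int[m2]_y (h (x, y))%:E)%E =
   (fubini_F m2 ((EFin \o h)^\+) \- fubini_F m2 ((EFin \o h)^\-))%E.
  apply/funext => x; rewrite [LHS]integralE; congr (_ - _)%E;
    by apply: eq_integral => y _; rewrite ?funeposE ?funenegE.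
by apply: emeasurable_funB; apply: measurable_fun_fubini_tonelli_F => //;
  [exact: measurable_funepos|exact: measurable_funeneg].
Qed.

Lemma Rintegral_prod (h : T1 * T2 -> R) :
  (m1 \x m2)%E.-integrable setT (EFin \o h) ->
  (forall x, m2.-integrable setT (EFin \o (fun y => h (x, y)))) ->
  \int[(m1 \x m2)%E]_z h z = \int[m1]_x \int[m2]_y h (x, y).
Proof.
move=> ih ih1; rewrite /Rintegral -(@integral12_prod_meas1 _ _ _ _ _ m1 m2) //; congr fine.
apply: eq_integral => x _; rewrite /fubini_F fineK//.
exact: (integrable_fin_num _ (ih1 x)).
Qed.

(** Every exchange of integrals over R^3 in the Plancherel argument that involves signed functions
    has this shape: two integrable factors and a bounded kernel. *)
Lemma Rintegral_swap (w : T1 -> R) (u : T2 -> R) (b : T1 -> T2 -> R) (C : R) :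
  m1.-integrable setT (EFin \o w) -> m2.-integrable setT (EFin \o u) ->
  measurable_fun setT (fun z => b z.1 z.2) -> (forall x y, `|b x y| <= C) ->
  \int[m1]_x (w x * \int[m2]_y (u y * b x y)) =
  \int[m2]_y (u y * \int[m1]_x (w x * b x y)).
Proof.
move=> iw iu mb bC.
have /integrableP[/measurable_EFinP mw _] := iw.
have /integrableP[/measurable_EFinP mu _] := iu.
have C0 : 0 <= `|C| by [].
have bC' x y : `|b x y| <= `|C| by rewrite (le_trans (bC x y))// ler_norm.
have iub x : m2.-integrable setT (EFin \o (fun y => u y * b x y)).
  have /= iC := integrableZl measurableT `|C| (integrable_abse iu).
  apply: (le_integrable measurableT _ _ iC).
    apply/measurable_EFinP; apply: measurable_funM => //.
    exact: (measurableT_comp mb (measurable_pair1 x)).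
  move=> y _ /=; rewrite lee_fin !normrM !normr_id mulrC.
  by apply: ler_pM.
have iwb y : m1.-integrable setT (EFin \o (fun x => w x * b x y)).
  have /= iC := integrableZl measurableT `|C| (integrable_abse iw).
  apply: (le_integrable measurableT _ _ iC).
    apply/measurable_EFinP; apply: measurable_funM => //.
    exact: (measurableT_comp mb (measurable_pair2 y)).
  move=> x _ /=; rewrite lee_fin !normrM !normr_id mulrC.
  by apply: ler_pM.
pose f (z : T1 * T2) := (w z.1 * (u z.2 * b z.1 z.2))%:E.
have mf : measurable_fun setT f.
  apply/measurable_EFinP; apply: measurable_funM.
    exact: (measurableT_comp mw measurable_fst).
  by apply: measurable_funM => //; exact: (measurableT_comp mu measurable_snd).
have if_ : (m1 \x m2)%E.-integrable setT f.
  have iau := integrable_abse iu; have iaw := integrable_abse iw.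
  apply/integrable12ltyP => //.
  apply: (@le_lt_trans _ _ (\int[m1]_x ((`|w x|)%:E * (`|C|%:E * \int[m2]_y (`|u y|)%:E)))%E).
    apply: ge0_le_integral => //.
    - by move=> x _; exact: integral_ge0.
    - apply: (@measurable_fun_fubini_tonelli_F _ _ _ _ _ m2 (fun z => `|f z|%E)) => //.
      exact: measurableT_comp.
    - apply: emeasurable_funM => //; first exact: (measurable_int _ iaw).
    move=> x _.
    have -> : (`|w x|%:E * (`|C|%:E * \int[m2]_y `|u y|%:E) =
        \int[m2]_y ((`|w x| * `|C|)%:E * `|u y|%:E))%E.
      by rewrite ge0_integralZl// ?lee_fin ?mulr_ge0// ?EFinM ?muleA//; exact: (measurable_int _ iau).
    apply: ge0_le_integral => //.
    - by apply: measurableT_comp => //; exact: (measurableT_comp mf (measurable_pair1 x)).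
    - by apply: emeasurable_funM => //; exact: (measurable_int _ iau).
    move=> y _ /=; rewrite -!EFinM lee_fin !normrM -mulrA ler_wpM2l//.
    by rewrite mulrC ler_wpM2r.
  rewrite ge0_integralZr//.
  - apply: lte_mul_pinfty.
    + by apply: integral_ge0.
    + rewrite ge0_fin_numE; last exact: integral_ge0.
      by have /integrableP[_] := iaw; under eq_integral do rewrite /= normr_id.
    + rewrite lte_mul_pinfty//.
      by have /integrableP[_] := iau; under eq_integral do rewrite /= normr_id.
  - exact: (measurable_int _ iaw).
  - by rewrite mule_ge0// integral_ge0.
have := Fubini if_; rewrite /f => F.
transitivity (fine (\int[m1]_x \int[m2]_y (w x * (u y * b x y))%:E)%E).
  rewrite /Rintegral; congr fine; apply: eq_integral => x _.
  rewrite EFinM fineK; last exact: (integrable_fin_num _ (iub x)).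
  by rewrite -integralZl//; exact: iub.
rewrite F /Rintegral; congr fine; apply: eq_integral => y _.
rewrite EFinM fineK; last exact: (integrable_fin_num _ (iwb y)).
rewrite -integralZl//; last exact: iwb.
by apply: eq_integral => x _; rewrite -EFinM mulrCA.
Qed.

End FubiniReal.

(** * Poisson kernels as cosine transforms *)

Section PoissonKernel.
Variable R : realType.
Let leb := @lebesgue_measure R.

Lemma integrable_cos d (T : measurableType d) (m : {measure set T -> \bar R})
    (V Y : T -> R) (p : R) : m.-integrable setT (EFin \o V) -> measurable_fun setT Y ->
  m.-integrable setT (EFin \o (fun x => V x * cos (p + Y x))).
Proof.
move=> iV mY; apply: (le_integrable measurableT _ _ iV).
  have /integrableP[/measurable_EFinP mV _] := iV.
  apply/measurable_EFinP; apply: measurable_funM => //.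
  apply: (measurableT_comp (continuous_measurable_fun (@continuous_cos R))).
  exact: measurable_funD.
by move=> x _ /=; rewrite lee_fin normrM ler_piMr// normr_cos_le.
Qed.

(** The phase factors out as cos p exactly when the sine integral vanishes, as it does for even
    weights. Quantifying over p makes the property stable under products: when the last coordinate
    is integrated first, p + Z plays the part of the phase. *)
Definition has_cos_transform d (T : measurableType d) (m : {measure set T -> \bar R})
    (W Z : T -> R) (k : R) :=
  [/\ measurable_fun setT W, forall x, 0 <= W x, (\int[m]_x (W x)%:E < +oo)%E,
      measurable_fun setT Z & forall p, \int[m]_x (W x * cos (p + Z x)) = cos p * k].

Definition poisson (e c : R) := 2 * e / (e ^+ 2 + c ^+ 2).

Lemma has_cos_transform_laplace (e c : R) : 0 < e ->
  has_cos_transform leb (fun x => expR (- (e * `|x|))) (fun x => c * x) (poisson e c).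
Proof.
move=> e0; split.
- exact: measurable_laplace.
- by move=> x; exact: expR_ge0.
- by rewrite integralT_laplace// ltry.
- exact: measurable_funM.
- by move=> p; exact: integralT_laplace_cos.
Qed.

Lemma has_cos_transform_prod d (T : measurableType d)
    (m : {sigma_finite_measure set T -> \bar R}) (W Z : T -> R) (k e c : R) : 0 < e ->
  has_cos_transform m W Z k ->
  has_cos_transform (sf_prod m leb) (fun z => W z.1 * expR (- (e * `|z.2|)))
    (fun z => Z z.1 + c * z.2) (k * poisson e c).
Proof.
move=> e0 [mW W0 iW mZ hW].
have [mL L0 iL _ hL] := has_cos_transform_laplace c e0.
have mWL : measurable_fun setT (fun z : T * R => W z.1 * expR (- (e * `|z.2|))).
  by apply: measurable_funM; [exact: (measurableT_comp mW measurable_fst)|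
    exact: (measurableT_comp mL measurable_snd)].
have WL0 (z : T * R) : 0 <= W z.1 * expR (- (e * `|z.2|)) by rewrite mulr_ge0.
have mZc : measurable_fun setT (fun z : T * R => Z z.1 + c * z.2).
  apply: measurable_funD; first exact: (measurableT_comp mZ measurable_fst).
  by apply: measurable_funM => //; exact: measurable_snd.
have fin : (\int[sf_prod m leb]_z (W z.1 * expR (- (e * `|z.2|)))%:E < +oo)%E.
  rewrite (@ge0_integral_prod_sep _ _ _ _ _ m leb W (fun y => expR (- (e * `|y|))))//.
  rewrite integralT_laplace//.
  have : (\int[m]_x (W x)%:E)%E \is a fin_num.
    by rewrite ge0_fin_numE// integral_ge0// => x _; rewrite lee_fin.
  by case: (\int[m]_x (W x)%:E)%E => // r _; rewrite -EFinM ltry.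
split => // p.
have ic (x : T) : leb.-integrable setT
    (EFin \o (fun y => expR (- (e * `|y|)) * cos (p + Z x + c * y))).
  by apply: integrable_cos; [exact: integrable_laplace|exact: measurable_funM].
rewrite (@Rintegral_prod _ _ _ _ _ m leb (fun z => W z.1 * expR (- (e * `|z.2|)) * cos (p + (Z z.1 + c * z.2)))).
- transitivity (\int[m]_x (poisson e c * (W x * cos (p + Z x)))).
    apply: eq_Rintegral => x _ /=.
    transitivity (\int[leb]_y (W x * (expR (- (e * `|y|)) * cos (p + Z x + c * y)))).
      by apply: eq_Rintegral => y _; rewrite addrA mulrA.
    by rewrite RintegralZl// hL; ring.
  rewrite RintegralZl//; first by rewrite hW; ring.
  by apply: integrable_cos => //; exact: ge0_integrable.
- have iWL : (m \x leb)%E.-integrable setT (EFin \o (fun z => W z.1 * expR (- (e * `|z.2|)))).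
    by apply: ge0_integrable.
  exact: integrable_cos.
move=> x /=.
have -> : (fun y : R => W x * expR (- (e * `|y|)) * cos (p + (Z x + c * y))) =
    (fun y => W x * (expR (- (e * `|y|)) * cos (p + Z x + c * y))).
  by apply/funext => y; rewrite mulrA addrA.
exact: integrableZl_EFin.
Qed.

(** This non-radial weight is chosen because its transform is a product of elementary
    one-dimensional integrals and is visibly nonnegative. *)
Definition laplace3 (e : R) (xi : R3 R) :=
  expR (- (e * `|xi.1.1|)) * expR (- (e * `|xi.1.2|)) * expR (- (e * `|xi.2|)).

Definition poisson3 (e : R) (z : R3 R) :=
  poisson e z.1.1 * poisson e z.1.2 * poisson e z.2.

Lemma integral_laplace3_cos (e : R) (z : R3 R) : 0 < e ->
  \int[leb3 R]_xi (laplace3 e xi * cos (dotR3 z xi)) = poisson3 e z.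
Proof.
move=> e0.
have := has_cos_transform_prod z.2 e0 (has_cos_transform_prod z.1.2 e0
  (has_cos_transform_laplace z.1.1 e0)).
move=> [_ _ _ _ /(_ 0)]; rewrite cos0 mul1r /poisson3 => <-.
by apply: eq_Rintegral => xi _; rewrite add0r.
Qed.

Lemma integrable_laplace3 (e : R) : 0 < e ->
  (leb3 R).-integrable setT (EFin \o laplace3 e).
Proof.
move=> e0.
have [h1 h2 h3 _ _] := has_cos_transform_prod 0 e0 (has_cos_transform_prod 0 e0
  (has_cos_transform_laplace 0 e0)).
exact: (ge0_integrable h1 h2 h3).
Qed.

Lemma poisson_ge0 (e c : R) : 0 < e -> 0 <= poisson e c.
Proof. by move=> e0; rewrite divr_ge0 ?mulr_ge0 ?addr_ge0 ?sqr_ge0 ?(ltW e0). Qed.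

Lemma measurable_poisson (e x : R) : 0 < e -> measurable_fun setT (fun y : R => poisson e (x - y)).
Proof.
move=> e0; apply: continuous_measurable_fun => y.
apply: cvgM; first exact: cvg_cst.
apply: cvgV; first by rewrite gt_eqF// ltr_pwDl ?exprn_gt0 ?sqr_ge0.
apply: cvgD; first exact: cvg_cst.
apply: (@cvg_comp _ _ _ (fun y : R => x - y) (fun u => u ^+ 2)); last exact: exprn_continuous.
by apply: cvgB; [exact: cvg_cst|exact: cvg_id].
Qed.

Lemma integral_poisson (e x : R) : 0 < e ->
  (\int[leb]_y (poisson e (x - y))%:E = (2 * pi)%:E)%E.
Proof.
move=> e0.
have E (y : R) : poisson e (x - y) = 2 * (e^-1 / (1 + (e^-1 * (y - x)) ^+ 2)).
  have p1 : e ^+ 2 + (x - y) ^+ 2 != 0 by rewrite gt_eqF// ltr_pwDl ?exprn_gt0 ?sqr_ge0.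
  have p2 : e ^+ 2 + (y - x) ^+ 2 != 0 by rewrite gt_eqF// ltr_pwDl ?exprn_gt0 ?sqr_ge0.
  rewrite /poisson; field.
  by rewrite gt_eqF.
have e1 : 0 < e^-1 by rewrite invr_gt0.
have den (y : R) : 0 < 1 + (e^-1 * (y - x)) ^+ 2 by rewrite ltr_pwDl ?sqr_ge0.
under eq_integral => y _ do rewrite E EFinM.
rewrite ge0_integralZl//.
- by rewrite integralT_poisson// -EFinM.
- apply/measurable_EFinP.
  have -> : (fun y => e^-1 / (1 + (e^-1 * (y - x)) ^+ 2)) = (fun y => 2^-1 * poisson e (x - y)).
    by apply/funext => y; rewrite E mulrA mulVf// mul1r.
  by apply: measurable_funM => //; exact: measurable_poisson.
- by move=> y _; rewrite lee_fin divr_ge0 ?(ltW e1) ?(ltW (den y)).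
Qed.

Lemma integral_poisson3 (e : R) (x : R3 R) : 0 < e ->
  (\int[leb3 R]_y (poisson3 e (x - y))%:E = ((2 * pi) ^+ 3)%:E)%E.
Proof.
move=> e0; rewrite (@ge0_integral3_sep _ (fun y : R => poisson e (x.1.1 - y)) (fun y : R => poisson e (x.1.2 - y))
  (fun y : R => poisson e (x.2 - y))); last 6 first.
- exact: measurable_poisson.
- exact: measurable_poisson.
- exact: measurable_poisson.
- by move=> y; exact: poisson_ge0.
- by move=> y; exact: poisson_ge0.
- by move=> y; exact: poisson_ge0.
by rewrite !integral_poisson// -!EFinM; congr (_%:E); ring.
Qed.

End PoissonKernel.

(** * Weighted square integrals of the transform *)

Section FourierTransforms.
Variable R : realType.
Let leb := @lebesgue_measure R.
Let leb2 := sf_prod leb leb.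
Let mu3 := sf_prod leb2 leb.
Local Notation mu := (leb3 R).

(** Without the normalising factor: for real integrable u, the sum of the squares of the two
    transforms is (2 pi)^6 |fourier u|^2. The Plancherel inequality is proved for real u first. *)
Definition cos_fourier (u : R3 R -> R) (xi : R3 R) := \int[mu]_x (u x * cos (dotR3 x xi)).
Definition sin_fourier (u : R3 R -> R) (xi : R3 R) := \int[mu]_x (u x * sin (dotR3 x xi)).

Lemma normr_Rintegral_le d (T : measurableType d) (m : {measure set T -> \bar R}) (f : T -> R) :
  measurable_fun setT f -> (`|\int[m]_x f x|%:E <= \int[m]_x `|f x|%:E)%E.
Proof.
move=> mf; have [->|foo] := eqVneq (\int[m]_x `|f x|%:E)%E +oo%E; first exact: leey.
have jf : m.-integrable setT (EFin \o f).
  by apply/integrableP; split; [exact/measurable_EFinP|rewrite ltey].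
have N : (\int[m]_x `|f x|)%:E = (\int[m]_x `|f x|%:E)%E.
  by rewrite /Rintegral fineK//; exact: (integrable_fin_num _ (integrable_abse jf)).
by rewrite -N lee_fin le_normr_Rintegral.
Qed.

Lemma Rintegral3_swap (w u : R3 R -> R) (b : R3 R -> R3 R -> R) (C : R) :
  mu.-integrable setT (EFin \o w) -> mu.-integrable setT (EFin \o u) ->
  measurable_fun setT (fun z : R3 R * R3 R => b z.1 z.2) -> (forall x y, `|b x y| <= C) ->
  \int[mu]_x (w x * \int[mu]_y (u y * b x y)) =
  \int[mu]_y (u y * \int[mu]_x (w x * b x y)).
Proof. exact: (@Rintegral_swap _ _ _ _ _ mu3 mu3). Qed.

Lemma measurable_cos_fourier (u : R3 R -> R) : measurable_fun setT u ->
  measurable_fun setT (cos_fourier u).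
Proof.
move=> mu_; apply: (@measurable_Rintegral_snd _ _ _ _ _ mu3 (fun z => u z.2 * cos (dotR3 z.2 z.1))).
apply: measurable_funM; first exact: (measurableT_comp mu_ measurable_snd).
apply: (measurableT_comp (continuous_measurable_fun (@continuous_cos R))).
exact: measurable_dotR3.
Qed.

Lemma measurable_sin_fourier (u : R3 R -> R) : measurable_fun setT u ->
  measurable_fun setT (sin_fourier u).
Proof.
move=> mu_; apply: (@measurable_Rintegral_snd _ _ _ _ _ mu3 (fun z => u z.2 * sin (dotR3 z.2 z.1))).
apply: measurable_funM; first exact: (measurableT_comp mu_ measurable_snd).
apply: (measurableT_comp (continuous_measurable_fun (@continuous_sin R))).
exact: measurable_dotR3.
Qed.

Lemma integrable_cos_sin (u : R3 R -> R) (xi : R3 R) : mu.-integrable setT (EFin \o u) ->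
  mu.-integrable setT (EFin \o (fun x => u x * cos (dotR3 x xi))) /\
  mu.-integrable setT (EFin \o (fun x => u x * sin (dotR3 x xi))).
Proof.
move=> iu; have /integrableP[/measurable_EFinP mu_ _] := iu.
have md : measurable_fun setT (fun x => dotR3 x xi) by exact: measurable_dotR3.
have in_ := integrable_abse iu.
split; apply: integrable_dom in_ _.
- apply: measurable_funM => //.
  exact: (measurableT_comp (continuous_measurable_fun (@continuous_cos R)) md).
- by move=> x; rewrite normrM ler_piMr// normr_cos_le.
- apply: measurable_funM => //.
  exact: (measurableT_comp (continuous_measurable_fun (@continuous_sin R)) md).
- by move=> x; rewrite normrM ler_piMr// normr_sin_le.
Qed.

Lemma normr_cos_sin_fourier_le (u : R3 R -> R) (xi : R3 R) : mu.-integrable setT (EFin \o u) ->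
  `|cos_fourier u xi| <= \int[mu]_x `|u x| /\ `|sin_fourier u xi| <= \int[mu]_x `|u x|.
Proof.
move=> iu; have [ic is_] := integrable_cos_sin xi iu.
have in_ := integrable_abse iu.
split; (apply: (le_trans (le_normr_Rintegral _ _)) => //; apply: le_Rintegral => //).
- exact: (integrable_abse ic).
- by move=> x _; rewrite normrM ler_piMr// normr_cos_le.
- exact: (integrable_abse is_).
- by move=> x _; rewrite normrM ler_piMr// normr_sin_le.
Qed.

Lemma cos_sin_rot (u : R3 R -> R) (x xi : R3 R) : mu.-integrable setT (EFin \o u) ->
  cos (dotR3 x xi) * cos_fourier u xi + sin (dotR3 x xi) * sin_fourier u xi =
  \int[mu]_y (u y * cos (dotR3 (x - y) xi)).
Proof.
move=> iu; have [ic is_] := integrable_cos_sin xi iu.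
rewrite -RintegralZl// -[X in _ + X]RintegralZl// -RintegralD//; last 2 first.
- exact: integrableZl_EFin.
- exact: integrableZl_EFin.
apply: eq_Rintegral => y _.
have -> : dotR3 (x - y) xi = dotR3 x xi - dotR3 y xi by rewrite /dotR3 /=; ring.
by rewrite cosB; ring.
Qed.

(** The square is expanded one copy of u at a time, each followed by an exchange of integrals. The
    phases combine into cos ((x - y) . xi), whose integral against the weight is the Poisson
    kernel. *)
Lemma integral_laplace3_fourier (u : R3 R -> R) (e : R) : 0 < e ->
  mu.-integrable setT (EFin \o u) ->
  \int[mu]_xi (laplace3 e xi * (cos_fourier u xi ^+ 2 + sin_fourier u xi ^+ 2)) =
  \int[mu]_x (u x * \int[mu]_y (u y * poisson3 e (x - y))).
Proof.
move=> e0 iu; have iw := integrable_laplace3 e0.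
have /integrableP[/measurable_EFinP mu_ _] := iu.
pose U := \int[mu]_x `|u x|.
have mA := measurable_cos_fourier mu_; have mB := measurable_sin_fourier mu_.
(* The copy not yet expanded sits in a kernel bounded by twice the L^1 norm of u, as the exchange
   requires. *)
pose b1 xi x := cos (dotR3 x xi) * cos_fourier u xi + sin (dotR3 x xi) * sin_fourier u xi.
have mb1 : measurable_fun setT (fun z => b1 z.1 z.2).
  have md : measurable_fun setT (fun z : R3 R * R3 R => dotR3 z.2 z.1) by exact: measurable_dotR3.
  apply: measurable_funD; apply: measurable_funM.
  - exact: (measurableT_comp (continuous_measurable_fun (@continuous_cos R)) md).
  - exact: (measurableT_comp mA measurable_fst).
  - exact: (measurableT_comp (continuous_measurable_fun (@continuous_sin R)) md).
  - exact: (measurableT_comp mB measurable_fst).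
have b1U xi x : `|b1 xi x| <= U + U.
  have [h1 h2] := normr_cos_sin_fourier_le xi iu.
  by rewrite (le_trans (normr_rotD_le _ _ _))// lerD.
transitivity (\int[mu]_xi (laplace3 e xi * \int[mu]_x (u x * b1 xi x))).
  apply: eq_Rintegral => xi _; congr (_ * _).
  have [ic is_] := integrable_cos_sin xi iu.
  rewrite !expr2 -RintegralZr// -[X in _ + X]RintegralZr// -RintegralD//; last 2 first.
  - by under eq_fun do rewrite mulrC; exact: integrableZl_EFin.
  - by under eq_fun do rewrite mulrC; exact: integrableZl_EFin.
  by apply: eq_Rintegral => x _; rewrite /b1; ring.
rewrite (Rintegral3_swap iw iu mb1 b1U).
apply: eq_Rintegral => x _; congr (_ * _).
transitivity (\int[mu]_xi (laplace3 e xi * \int[mu]_y (u y * cos (dotR3 (x - y) xi)))).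
  by apply: eq_Rintegral => xi _; rewrite -cos_sin_rot.
rewrite (@Rintegral3_swap _ _ (fun xi y => cos (dotR3 (x - y) xi)) 1 iw iu).
- by apply: eq_Rintegral => y _; rewrite integral_laplace3_cos.
- apply: (measurableT_comp (continuous_measurable_fun (@continuous_cos R))).
  have md : measurable_fun setT (fun z : R3 R * R3 R => dotR3 z.2 z.1) by exact: measurable_dotR3.
  have mx : measurable_fun setT (fun z : R3 R * R3 R => dotR3 x z.1) by exact: measurable_dotR3.
  have -> : (fun z : R3 R * R3 R => dotR3 (x - z.2) z.1) = (fun z => dotR3 x z.1 - dotR3 z.2 z.1).
    by apply/funext => z; rewrite /dotR3 /=; ring.
  exact: measurable_funB.
- by move=> xi y; exact: normr_cos_le.
Qed.

End FourierTransforms.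

(** * Schur test for the Poisson kernel *)

Section PoissonForm.
Variable R : realType.
Let leb := @lebesgue_measure R.
Let mu3 := sf_prod (sf_prod leb leb) leb.
Local Notation mu := (leb3 R).

Lemma tonelli3 (f : R3 R * R3 R -> \bar R) : measurable_fun setT f ->
  (forall z, 0 <= f z)%E ->
  (\int[mu]_x \int[mu]_y f (x, y) = \int[mu]_y \int[mu]_x f (x, y))%E.
Proof. exact: (@fubini_tonelli _ _ _ _ _ mu3 mu3 f). Qed.

Lemma measurable_tonelli3 (f : R3 R * R3 R -> \bar R) : measurable_fun setT f ->
  (forall z, 0 <= f z)%E -> measurable_fun setT (fun x => \int[mu]_y f (x, y))%E.
Proof. exact: (@measurable_fun_fubini_tonelli_F _ _ _ _ _ mu3 f). Qed.

Lemma measurable_Rintegral3 (h : R3 R * R3 R -> R) : measurable_fun setT h ->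
  measurable_fun setT (fun x => \int[mu]_y h (x, y)).
Proof. exact: (@measurable_Rintegral_snd _ _ _ _ _ mu3 h). Qed.

Lemma poisson3_ge0 (e : R) (z : R3 R) : 0 < e -> 0 <= poisson3 e z.
Proof. by move=> e0; apply: mulr_ge0; [apply: mulr_ge0|]; exact: poisson_ge0. Qed.

Lemma poisson3C (e : R) (x y : R3 R) : poisson3 e (x - y) = poisson3 e (y - x).
Proof.
rewrite /poisson3 /poisson /=.
by rewrite -(sqrrN (x.1.1 - y.1.1)) -(sqrrN (x.1.2 - y.1.2)) -(sqrrN (x.2 - y.2)) !opprB.
Qed.

Lemma measurable_poisson_comp d (T : measurableType d) (e : R) (f : T -> R) : 0 < e ->
  measurable_fun setT f -> measurable_fun setT (fun t => poisson e (f t)).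
Proof.
move=> e0 mf; have := measurable_poisson 0 e0; rewrite -/leb => mp.
have -> : (fun t => poisson e (f t)) = (fun y => poisson e (0 - y)) \o f.
  by apply/funext => t /=; rewrite /poisson sub0r sqrrN.
exact: (measurableT_comp mp mf).
Qed.

Lemma measurable_poisson3 (e : R) : 0 < e ->
  measurable_fun setT (fun z : R3 R * R3 R => poisson3 e (z.1 - z.2)).
Proof.
move=> e0.
have f1 : measurable_fun setT (fun z : R3 R * R3 R => z.1) := measurable_fst.
have f2 : measurable_fun setT (fun z : R3 R * R3 R => z.2) := measurable_snd.
have g1 := measurableT_comp measurable_fst f1; have g2 := measurableT_comp measurable_fst f2.
apply: measurable_funM; [apply: measurable_funM|]; apply: measurable_poisson_comp => //;
  apply: measurable_funB.
- exact: (measurableT_comp measurable_fst g1).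
- exact: (measurableT_comp measurable_fst g2).
- exact: (measurableT_comp measurable_snd g1).
- exact: (measurableT_comp measurable_snd g2).
- exact: (measurableT_comp measurable_snd f1).
- exact: (measurableT_comp measurable_snd f2).
Qed.

(** Schur test: |u(x) u(y)| <= (u(x)^2 + u(y)^2) / 2, and the kernel is nonnegative, symmetric and
    of mass (2 pi)^3, so each half contributes half of the right side. Tonelli is applied only to
    nonnegative functions, so the right side may be infinite. *)
Lemma poisson3_form_le (u : R3 R -> R) (e : R) : 0 < e -> measurable_fun setT u ->
  ((\int[mu]_x (u x * \int[mu]_y (u y * poisson3 e (x - y))))%:E <=
   ((2 * pi) ^+ 3)%:E * \int[mu]_x (u x ^+ 2)%:E)%E.
Proof.
move=> e0 mu_.
have P0 z := poisson3_ge0 z e0; have mP := measurable_poisson3 e0.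
have c0 : 0 <= (2 * pi) ^+ 3 :> R by rewrite exprn_ge0// mulr_ge0// pi_ge0.
have mu1 : measurable_fun setT (fun z : R3 R * R3 R => u z.1) by exact: (measurableT_comp mu_ measurable_fst).
have mu2 : measurable_fun setT (fun z : R3 R * R3 R => u z.2) by exact: (measurableT_comp mu_ measurable_snd).
have msq : measurable_fun setT (fun x => u x ^+ 2) by exact: measurable_funX.
have I0 : (0 <= \int[mu]_x (u x ^+ 2)%:E)%E by apply: integral_ge0 => x _; rewrite lee_fin sqr_ge0.
pose f1 (z : R3 R * R3 R) := (u z.1 ^+ 2 / 2 * poisson3 e (z.1 - z.2))%:E.
pose f2 (z : R3 R * R3 R) := (u z.2 ^+ 2 / 2 * poisson3 e (z.1 - z.2))%:E.
have mf1 : measurable_fun setT f1.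
  by apply/measurable_EFinP; apply: measurable_funM => //; apply: measurable_funM => //; exact: measurable_funX.
have mf2 : measurable_fun setT f2.
  by apply/measurable_EFinP; apply: measurable_funM => //; apply: measurable_funM => //; exact: measurable_funX.
have f10 z : (0 <= f1 z)%E by rewrite lee_fin mulr_ge0// divr_ge0// sqr_ge0.
have f20 z : (0 <= f2 z)%E by rewrite lee_fin mulr_ge0// divr_ge0// sqr_ge0.
have half (x : R3 R) : (\int[mu]_y (u x ^+ 2 / 2 * poisson3 e (x - y))%:E = (u x ^+ 2 / 2 * (2 * pi) ^+ 3)%:E)%E.
  under eq_integral do rewrite EFinM.
  rewrite ge0_integralZl//; last 3 first.
  - apply/measurable_EFinP; exact: (measurableT_comp mP (measurable_pair1 x)).
  - by move=> y _; rewrite lee_fin.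
  - by rewrite lee_fin divr_ge0// sqr_ge0.
  by rewrite integral_poisson3// -EFinM.
have tot : (\int[mu]_x (u x ^+ 2 / 2 * (2 * pi) ^+ 3)%:E =
    (2^-1)%:E * (((2 * pi) ^+ 3)%:E * \int[mu]_x (u x ^+ 2)%:E))%E.
  rewrite muleA -EFinM -ge0_integralZl//; last 3 first.
  - exact/measurable_EFinP.
  - by move=> y _; rewrite lee_fin sqr_ge0.
  - by rewrite lee_fin mulr_ge0.
  by apply: eq_integral => x _; rewrite -EFinM; congr (_%:E); ring.
have T1 : (\int[mu]_x \int[mu]_y f1 (x, y) = (2^-1)%:E * (((2 * pi) ^+ 3)%:E * \int[mu]_x (u x ^+ 2)%:E))%E.
  by rewrite -tot; apply: eq_integral => x _; rewrite /f1 /= half.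
have T2 : (\int[mu]_x \int[mu]_y f2 (x, y) = (2^-1)%:E * (((2 * pi) ^+ 3)%:E * \int[mu]_x (u x ^+ 2)%:E))%E.
  rewrite (tonelli3 mf2 f20) -tot; apply: eq_integral => y _; rewrite /f2 /=.
  by under eq_integral do rewrite poisson3C; rewrite half.
have -> : (((2 * pi) ^+ 3)%:E * \int[mu]_x (u x ^+ 2)%:E =
    \int[mu]_x (\int[mu]_y f1 (x, y) + \int[mu]_y f2 (x, y)))%E.
  rewrite ge0_integralD; last 5 first.
  - exact: measurableT.
  - by move=> x _; exact: integral_ge0.
  - exact: measurable_tonelli3.
  - by move=> x _; exact: integral_ge0.
  - exact: measurable_tonelli3.
  rewrite T1 T2 -ge0_muleDl ?lee_fin ?invr_ge0// -EFinD.
  by rewrite (_ : 2^-1 + 2^-1 = 1 :> R) ?mul1e//; field.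
pose h (z : R3 R * R3 R) := u z.2 * poisson3 e (z.1 - z.2).
have mh : measurable_fun setT h by exact: measurable_funM.
have mg : measurable_fun setT (fun x => u x * \int[mu]_y (u y * poisson3 e (x - y))).
  by apply: measurable_funM; [exact: mu_|exact: (measurable_Rintegral3 mh)].
apply: (@le_trans _ _ (`|\int[mu]_x (u x * \int[mu]_y (u y * poisson3 e (x - y)))|%:E)).
  by rewrite lee_fin ler_norm.
apply: (le_trans (normr_Rintegral_le mu mg)).
apply: ge0_le_integral; [exact: measurableT|by move=> x _; rewrite lee_fin| | |].
- by apply/measurable_EFinP; exact: (measurableT_comp (@normr_measurable R setT) mg).
- by apply: emeasurable_funD; exact: measurable_tonelli3.
move=> x _; rewrite normrM EFinM.
have mhx : measurable_fun setT (fun y => u y * poisson3 e (x - y)).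
  exact: (measurableT_comp mh (measurable_pair1 x)).
apply: (le_trans (lee_wpmul2l _ (normr_Rintegral_le mu mhx))) => //.
rewrite -ge0_integralZl//; last by apply/measurable_EFinP; exact: measurableT_comp.
rewrite -ge0_integralD//; last 2 first.
- exact: (measurableT_comp mf1 (measurable_pair1 x)).
- exact: (measurableT_comp mf2 (measurable_pair1 x)).
apply: ge0_le_integral; [exact: measurableT|by move=> y _; rewrite -EFinM lee_fin mulr_ge0| | |].
- apply/measurable_EFinP; apply: measurable_funM; first exact: measurable_cst.
  exact: (measurableT_comp (@normr_measurable R setT) mhx).
- by apply: emeasurable_funD; [exact: (measurableT_comp mf1 (measurable_pair1 x))|
    exact: (measurableT_comp mf2 (measurable_pair1 x))].
move=> y _; rewrite /f1 /f2 /= -EFinM -EFinD lee_fin normrM (ger0_norm (P0 _)) mulrA -mulrDl.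
rewrite ler_wpM2r//.
rewrite -(real_normK (num_real (u x))) -(real_normK (num_real (u y))).
by have := sqr_ge0 (`|u x| - `|u y|); lra.
Qed.

End PoissonForm.

Section PlancherelInequality.
Variable R : realType.
Local Notation mu := (leb3 R).
Local Notation normc := (@ComplexField.Normc.normc R).
Local Notation Re := (@complex.Re R).
Local Notation Im := (@complex.Im R).

Lemma integral_laplace3_fourier_le (u : R3 R -> R) (e : R) : 0 < e ->
  mu.-integrable setT (EFin \o u) ->
  (\int[mu]_xi (laplace3 e xi * (cos_fourier u xi ^+ 2 + sin_fourier u xi ^+ 2))%:E <=
   ((2 * pi) ^+ 3)%:E * \int[mu]_x (u x ^+ 2)%:E)%E.
Proof.
move=> e0 iu; have /integrableP[/measurable_EFinP mu_ _] := iu.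
have mA := measurable_cos_fourier mu_; have mB := measurable_sin_fourier mu_.
have iw := integrable_laplace3 e0.
have /integrableP[/measurable_EFinP mw _] := iw.
pose U := \int[mu]_x `|u x|.
have L0 xi : 0 <= laplace3 e xi by rewrite !mulr_ge0 ?expR_ge0.
(* Both transforms are bounded by the L^1 norm of u and the weight is integrable. The extended
   integral is therefore finite and equals the real integral computed above. *)
have iS : mu.-integrable setT (EFin \o
    (fun xi => laplace3 e xi * (cos_fourier u xi ^+ 2 + sin_fourier u xi ^+ 2))).
  apply: (@integrable_dom _ _ (fun xi => (U ^+ 2 + U ^+ 2) * laplace3 e xi)).
  - by apply: measurable_funM => //; apply: measurable_funD; exact: measurable_funX.
  - exact: integrableZl_EFin.
  move=> xi; have [h1 h2] := normr_cos_sin_fourier_le xi iu.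
  rewrite normrM (ger0_norm (L0 xi)) mulrC ler_wpM2r// ger0_norm ?addr_ge0 ?sqr_ge0//.
  rewrite -(real_normK (num_real (cos_fourier u xi))) -(real_normK (num_real (sin_fourier u xi))).
  by apply: lerD; apply: lerXn2r => //; rewrite nnegrE (le_trans (normr_ge0 _) h1).
rewrite -[leLHS]fineK; last exact: (integrable_fin_num _ iS).
have := integral_laplace3_fourier e0 iu; rewrite {1}/Rintegral => ->.
exact: poisson3_form_le.
Qed.

Lemma cvg_laplace3 (xi : R3 R) : laplace3 (@harmonic R n) xi @[n --> \oo] --> (1 : R).
Proof.
have h (x : R) : expR (- (@harmonic R n * `|x|)) @[n --> \oo] --> (1 : R).
  have H : - (@harmonic R n * `|x|) @[n --> \oo] --> - (0 * `|x|).
    by apply: cvgN; apply: cvgM; [exact: cvg_harmonic|exact: cvg_cst].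
  rewrite mul0r oppr0 in H.
  have := @continuous_expR R 0; rewrite /continuous_at expR0 => ce.
  exact: cvg_comp H ce.
have -> : (1 : R) = 1 * 1 * 1 by rewrite !mulr1.
by apply: cvgM; [apply: cvgM|]; exact: h.
Qed.

Lemma laplace3_mono (d e : R) (xi : R3 R) : d <= e -> laplace3 e xi <= laplace3 d xi.
Proof.
move=> de; have h (x : R) : expR (- (e * `|x|)) <= expR (- (d * `|x|)).
  by rewrite ler_expR lerN2 ler_wpM2r.
by apply: ler_pM; rewrite ?mulr_ge0 ?expR_ge0//; apply: ler_pM; rewrite ?expR_ge0.
Qed.

Lemma plancherel_le_real (u : R3 R -> R) : mu.-integrable setT (EFin \o u) ->
  (\int[mu]_xi (cos_fourier u xi ^+ 2 + sin_fourier u xi ^+ 2)%:E <=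
   ((2 * pi) ^+ 3)%:E * \int[mu]_x (u x ^+ 2)%:E)%E.
Proof.
move=> iu; have /integrableP[/measurable_EFinP mu_ _] := iu.
have mA := measurable_cos_fourier mu_; have mB := measurable_sin_fourier mu_.
pose S xi := cos_fourier u xi ^+ 2 + sin_fourier u xi ^+ 2.
have S0 xi : 0 <= S xi by rewrite addr_ge0 ?sqr_ge0.
have mS : measurable_fun setT S by apply: measurable_funD; exact: measurable_funX.
(* The parameter e runs through 1 / (n + 1). The weights increase to 1, so monotone convergence
   removes them although the limit integral is not yet known to be finite. *)
pose g (n : nat) xi := (laplace3 (@harmonic R n) xi * S xi)%:E.
have mg n : measurable_fun setT (g n).
  have /integrableP[/measurable_EFinP mw _] := integrable_laplace3 (@harmonic_gt0 R n).
  by apply/measurable_EFinP; exact: measurable_funM.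
have g0 n xi : [set: R3 R] xi -> (0 <= g n xi)%E.
  by move=> _; rewrite lee_fin mulr_ge0// !mulr_ge0 ?expR_ge0.
have ndg xi : [set: R3 R] xi -> nondecreasing_seq (g ^~ xi).
  move=> _ m n mn; rewrite lee_fin ler_wpM2r// laplace3_mono// /harmonic.
  by rewrite lef_pV2 ?posrE ?ltr0n// ler_nat.
have glim xi : limn (g ^~ xi) = (S xi)%:E.
  apply/cvg_lim => //; apply: cvg_EFin; first by apply: nearW.
  rewrite -[X in _ --> X]mul1r; apply: cvgM; [exact: cvg_laplace3|exact: cvg_cst].
have := monotone_convergence mu measurableT mg g0 ndg.
under eq_integral do rewrite glim.
move=> ->; apply: lime_le.
  apply: ereal_nondecreasing_is_cvgn => m n mn.
  by apply: ge0_le_integral => //; [exact: g0|exact: mg|exact: mg|move=> xi _; exact: ndg].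
apply: nearW => n; apply: integral_laplace3_fourier_le => //; exact: harmonic_gt0.
Qed.

Lemma fourierE (f : R3 R -> R[i]) (xi : R3 R) : cintegrable f ->
  let c : R := (2 * pi) ^- 3 in let a x := Re (f x) in let b x := Im (f x) in
  fourier f xi = Complex (c * (cos_fourier a xi + sin_fourier b xi))
                         (c * (cos_fourier b xi - sin_fourier a xi)).
Proof.
move=> jf c a b.
have ia : mu.-integrable setT (EFin \o a) := cintegrable_Re jf.
have ib : mu.-integrable setT (EFin \o b) := cintegrable_Im jf.
have [ac as_] := integrable_cos_sin xi ia; have [bc bs] := integrable_cos_sin xi ib.
rewrite /fourier /Cintegral -/c.
have -> : \int[mu]_x Re (cexp (- ('i * (dotR3 x xi)%:C))%C * f x) = cos_fourier a xi + sin_fourier b xi.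
  rewrite -RintegralD//; apply: eq_Rintegral => x _.
  have -> : (- ('i * (dotR3 x xi)%:C))%C = ('i * (- dotR3 x xi)%:C)%C by apply/eqP; rewrite eq_complex /=; apply/andP; split; apply/eqP; ring.
  by rewrite cexp_i cosN sinN /a /b; case: (f x) => p q /=; ring.
have -> : \int[mu]_x Im (cexp (- ('i * (dotR3 x xi)%:C))%C * f x) = cos_fourier b xi - sin_fourier a xi.
  rewrite -RintegralB//; apply: eq_Rintegral => x _.
  have -> : (- ('i * (dotR3 x xi)%:C))%C = ('i * (- dotR3 x xi)%:C)%C by apply/eqP; rewrite eq_complex /=; apply/andP; split; apply/eqP; ring.
  by rewrite cexp_i cosN sinN /a /b; case: (f x) => p q /=; ring.
by apply/eqP; rewrite eq_complex /=; apply/andP; split; apply/eqP; ring.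
Qed.

Lemma cmeasurable_fourier (f : R3 R -> R[i]) : cintegrable f -> cmeasurable (fourier f).
Proof.
move=> jf; have [[mr mi] _] := jf.
have [mar mbr] := (measurable_cos_fourier mr, measurable_sin_fourier mr).
have [mai mbi] := (measurable_cos_fourier mi, measurable_sin_fourier mi).
split; (under eq_fun => xi do rewrite fourierE//=); apply: measurable_funM => //.
  exact: measurable_funD.
exact: measurable_funB.
Qed.

Lemma inv_2pi3_ge0 : 0 <= (2 * pi) ^- 3 :> R.
Proof. by rewrite invr_ge0 exprn_ge0// mulr_ge0// pi_ge0. Qed.

Lemma normc_fourier_le (f : R3 R -> R[i]) (xi : R3 R) : cintegrable f ->
  normc (fourier f xi) <= (2 * pi) ^- 3 * (4 * \int[mu]_x normc (f x)).
Proof.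
have aux (p q r s N Na Nb : R) : `|p| <= Na -> `|q| <= Na -> `|r| <= Nb -> `|s| <= Nb ->
    Na <= N -> Nb <= N -> `|p + s| + `|r - q| <= 4 * N.
  by have := ler_normD p s; have := ler_normB r q; lra.
move=> jf; have [_ jn] := jf; have c0 := inv_2pi3_ge0.
have [ia ib] := (cintegrable_Re jf, cintegrable_Im jf).
have [a1 a2] := normr_cos_sin_fourier_le xi ia; have [b1 b2] := normr_cos_sin_fourier_le xi ib.
have hr : \int[mu]_x `|Re (f x)| <= \int[mu]_x normc (f x).
  apply: le_Rintegral => //; first exact: (integrable_abse ia).
  by move=> x _; exact: normr_Re_le.
have hi : \int[mu]_x `|Im (f x)| <= \int[mu]_x normc (f x).
  apply: le_Rintegral => //; first exact: (integrable_abse ib).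
  by move=> x _; exact: normr_Im_le.
rewrite fourierE// (le_trans (normc_le_ReIm _))//= !normrM (ger0_norm c0) -mulrDr ler_wpM2l//.
exact: aux a1 a2 b1 b2 hr hi.
Qed.

(** The real and imaginary parts of f mix in each component of the transform; (p + q)^2 <= 2 (p^2 +
    q^2) separates them at the price of the factor 2. The rest of the constant is (2 pi)^(-6) from
    the normalisation times (2 pi)^3. *)
Lemma plancherel_le (f : R3 R -> R[i]) : cintegrable f ->
  (\int[mu]_xi (normc (fourier f xi) ^+ 2)%:E <=
   (2 * (2 * pi) ^- 3)%:E * \int[mu]_x (normc (f x) ^+ 2)%:E)%E.
Proof.
move=> jf; have [[mr mi] _] := jf; have c0 := inv_2pi3_ge0.
have [ia ib] := (cintegrable_Re jf, cintegrable_Im jf).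
have nE (z : R[i]) : normc z ^+ 2 = Re z ^+ 2 + Im z ^+ 2.
  by case: z => p q /=; rewrite sqr_sqrtr ?addr_ge0 ?sqr_ge0.
have [mar mbr] := (measurable_cos_fourier mr, measurable_sin_fourier mr).
have [mai mbi] := (measurable_cos_fourier mi, measurable_sin_fourier mi).
pose c := (2 * pi) ^- 3 : R.
pose Sr xi := cos_fourier (fun x => Re (f x)) xi ^+ 2 + sin_fourier (fun x => Re (f x)) xi ^+ 2.
pose Si xi := cos_fourier (fun x => Im (f x)) xi ^+ 2 + sin_fourier (fun x => Im (f x)) xi ^+ 2.
have mSr : measurable_fun setT Sr by apply: measurable_funD; exact: measurable_funX.
have mSi : measurable_fun setT Si by apply: measurable_funD; exact: measurable_funX.
have Sr0 xi : 0 <= Sr xi by rewrite addr_ge0 ?sqr_ge0.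
have Si0 xi : 0 <= Si xi by rewrite addr_ge0 ?sqr_ge0.
have k0 : 0 <= 2 * c ^+ 2 by rewrite mulr_ge0 ?sqr_ge0.
apply: (@le_trans _ _ ((2 * c ^+ 2)%:E * (\int[mu]_xi (Sr xi)%:E + \int[mu]_xi (Si xi)%:E))%E).
  rewrite -ge0_integralD//; last 4 first.
  - by move=> x _; rewrite lee_fin.
  - exact/measurable_EFinP.
  - by move=> x _; rewrite lee_fin.
  - exact/measurable_EFinP.
  rewrite -ge0_integralZl//; last 2 first.
  - by apply/measurable_EFinP; exact: measurable_funD.
  - by move=> x _; rewrite -EFinD lee_fin addr_ge0.
  apply: ge0_le_integral => //.
  - by move=> x _; rewrite lee_fin sqr_ge0.
  - by apply/measurable_EFinP; apply: measurable_funX; apply: measurable_normc; exact: cmeasurable_fourier.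
  - by apply/measurable_EFinP; apply: measurable_funM => //; exact: measurable_funD.
  move=> xi _; rewrite -EFinD -EFinM lee_fin fourierE// nE /= /Sr /Si -/c.
  move: (cos_fourier _ _) (sin_fourier _ _) (cos_fourier _ _) (sin_fourier _ _) => p q r s.
  have := mulr_ge0 (sqr_ge0 c) (sqr_ge0 (p + q)); have := mulr_ge0 (sqr_ge0 c) (sqr_ge0 (r - s)).
  by rewrite !exprMn; lra.
have P1 := plancherel_le_real ia; have P2 := plancherel_le_real ib.
have -> : (\int[mu]_x (normc (f x) ^+ 2)%:E = \int[mu]_x (Re (f x) ^+ 2)%:E + \int[mu]_x (Im (f x) ^+ 2)%:E)%E.
  rewrite -ge0_integralD//; last 4 first.
  - by move=> x _; rewrite lee_fin sqr_ge0.
  - by apply/measurable_EFinP; exact: measurable_funX.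
  - by move=> x _; rewrite lee_fin sqr_ge0.
  - by apply/measurable_EFinP; exact: measurable_funX.
  by apply: eq_integral => x _; rewrite nE EFinD.
have -> : (2 * (2 * pi) ^- 3 = 2 * c ^+ 2 * (2 * pi) ^+ 3 :> R)%R.
  have p0 : pi != 0 :> R by rewrite gt_eqF// pi_gt0.
  by rewrite /c; move: (pi : R) p0 => p p0; field.
rewrite (EFinM (2 * c ^+ 2)) -muleA; apply: lee_wpmul2l; first by rewrite lee_fin.
rewrite ge0_muleDr; last 2 first.
- by apply: integral_ge0 => x _; rewrite lee_fin sqr_ge0.
- by apply: integral_ge0 => x _; rewrite lee_fin sqr_ge0.
exact: leeD.
Qed.

End PlancherelInequality.

(** * Derivatives of the solution *)

Section Symbols.
Variable R : realType.
Local Notation mu := (leb3 R).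
Local Notation normc := (@ComplexField.Normc.normc R).
Local Notation Re := (@complex.Re R).
Local Notation Im := (@complex.Im R).

Lemma cmeasurableM (p q : R3 R -> R[i]) : cmeasurable p -> cmeasurable q ->
  cmeasurable (fun xi => p xi * q xi).
Proof.
move=> [pr pi_] [qr qi]; split.
  have -> : (fun xi => Re (p xi * q xi)) = (fun xi => Re (p xi) * Re (q xi) - Im (p xi) * Im (q xi)).
    by apply/funext => xi; case: (p xi); case: (q xi).
  by apply: measurable_funB; exact: measurable_funM.
have -> : (fun xi => Im (p xi * q xi)) = (fun xi => Re (p xi) * Im (q xi) + Im (p xi) * Re (q xi)).
  by apply/funext => xi; case: (p xi); case: (q xi).
by apply: measurable_funD; exact: measurable_funM.
Qed.

Lemma cmeasurable_real (a : R3 R -> R) : measurable_fun setT a ->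
  cmeasurable (fun xi => ((a xi)%:C)%C).
Proof. by move=> ma; split => //; exact: measurable_cst. Qed.

Definition monom (e : R3 R) (k : nat) (Q : R3 R -> R[i]) (xi : R3 R) : R[i] :=
  ('i%C * ((dotR3 e xi)%:C)%C) ^+ k * Q xi.

(** An upper bound by |xi|^m is all that the estimates use of a monomial (i xi)^alpha, so partial
    and full space derivatives are treated alike. *)
Definition symbol_of_order (m : nat) (Q : R3 R -> R[i]) :=
  cmeasurable Q /\ forall xi, normc (Q xi) <= Num.sqrt (dotR3 xi xi) ^+ m.

Lemma symbol_of_order1 : symbol_of_order 0 (fun=> 1).
Proof. by split=> [|xi]; [split; exact: measurable_cst|rewrite ComplexField.Normc.normc1]. Qed.

Lemma symbol_of_order_monom (e : R3 R) (k m : nat) (Q : R3 R -> R[i]) :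
  (forall xi, `|dotR3 e xi| <= Num.sqrt (dotR3 xi xi)) ->
  symbol_of_order m Q -> symbol_of_order (k + m) (monom e k Q).
Proof.
move=> he; elim: k => [|k ih] [mQ hQ].
  rewrite add0n; have -> : monom e 0 Q = Q by apply/funext => xi; rewrite /monom expr0 mul1r.
  by [].
have [mq hq] := ih (conj mQ hQ).
have E xi : monom e k.+1 Q xi = 'i%C * ((dotR3 e xi)%:C)%C * monom e k Q xi.
  by rewrite /monom exprS mulrA.
split.
  have -> : monom e k.+1 Q = (fun xi => 'i%C * ((dotR3 e xi)%:C)%C * monom e k Q xi).
    by apply/funext.
  by apply: cintegrableM => //; exact: measurable_dotR3.
move=> xi; rewrite E 2!ComplexField.Normc.normcM normc_i mul1r normc_real addSn exprS.
by apply: ler_pM => //; exact: normc_ge0.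
Qed.

Variables (sigma : R) (sigma_gt0 : 0 < sigma) (f : R3 R -> R[i]) (jf : cintegrable f).

(** This family is closed under differentiation: a time derivative raises j, a space derivative
    multiplies Q by a monomial. The solution itself is j = 0, Q = 1. *)
Definition evol_symbol (j : nat) (Q : R3 R -> R[i]) (t : R) (xi : R3 R) : R[i] :=
  ((dmult sigma (dotR3 xi xi) j t)%:C)%C * (Q xi * fourier f xi).

Definition evol (j : nat) (Q : R3 R -> R[i]) (x : R3 R) (t : R) : R[i] :=
  inv_fourier (evol_symbol j Q t) x.

Lemma solutionE : solution sigma f = evol 0 (fun=> 1).
Proof.
have E t : (fun xi => multiplier sigma t xi * fourier f xi) = evol_symbol 0 (fun=> 1) t.
  by apply/funext => xi; rewrite /evol_symbol multiplierE mul1r.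
by apply/funext => x; apply/funext => t; rewrite /solution E.
Qed.

Lemma cmeasurable_evol_symbol j m Q t : symbol_of_order m Q -> cmeasurable (evol_symbol j Q t).
Proof.
move=> [mQ _]; apply: cmeasurableM; last by apply: cmeasurableM => //; exact: cmeasurable_fourier.
apply: cmeasurable_real.
exact: (measurableT_comp (@measurable_dmult R sigma j t) (@measurable_sqnorm R)).
Qed.

Lemma normc_evol_symbol j Q t xi : normc (evol_symbol j Q t xi) =
  `|dmult sigma (dotR3 xi xi) j t| * (normc (Q xi) * normc (fourier f xi)).
Proof. by rewrite /evol_symbol 2!ComplexField.Normc.normcM normc_real. Qed.

Definition weighted_fourier (q : R) (xi : R3 R) := (1 + dotR3 xi xi) `^ q * normc (fourier f xi).

Lemma weighted_fourier_ge0 q xi : 0 <= weighted_fourier q xi.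
Proof. by rewrite mulr_ge0 ?powR_ge0 ?normc_ge0. Qed.

Lemma measurable_weighted_fourier q : measurable_fun setT (weighted_fourier q).
Proof.
apply: measurable_funM; first exact: measurable_japanese.
by apply: measurable_normc; exact: cmeasurable_fourier.
Qed.

(** The exponent collects (1 + rho)^(j - 1) from the multiplier and rho^(n / 2) from a symbol of
    order n. The extra factor 1 + rho on the left turns it into natural powers. *)
Lemma weight_powR (j n : nat) (xi : R3 R) :
  (1 + dotR3 xi xi) * (1 + dotR3 xi xi) `^ (j%:R + n%:R / 2 - 1) =
  (1 + dotR3 xi xi) ^+ j * Num.sqrt (1 + dotR3 xi xi) ^+ n.
Proof.
have p0 : 0 < 1 + dotR3 xi xi by rewrite ltr_pwDl// dotR3_ge0.
rewrite -{1}[1 + dotR3 xi xi]powRr1 ?(ltW p0)// -powRD; last by apply/implyP => _; rewrite gt_eqF.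
rewrite (_ : 1 + (j%:R + n%:R / 2 - 1) = j%:R + n%:R / 2); last by ring.
rewrite powRD; last by apply/implyP => _; rewrite gt_eqF.
rewrite powR_mulrn ?(ltW p0)//; congr (_ * _).
by rewrite mulrC powRrM powR12_sqrt ?(ltW p0)// powR_mulrn// sqrtr_ge0.
Qed.

Lemma sqrt_sqnorm_le (xi : R3 R) :
  Num.sqrt (dotR3 xi xi) <= Num.sqrt (1 + dotR3 xi xi).
Proof. by rewrite ler_sqrt ?lerDr// addr_ge0 ?dotR3_ge0. Qed.

(** The constant A is free so that it can also carry the factor e^(- kappa t) in the decay
    estimate. *)
Lemma normc_evol_symbol_le (A : R) (j k m n : nat) Q t xi : (k <= j)%N -> (m <= n)%N ->
  symbol_of_order m Q -> 0 <= A ->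
  (1 + dotR3 xi xi) * `|dmult sigma (dotR3 xi xi) k t| <= A * (1 + dotR3 xi xi) ^+ k ->
  normc (evol_symbol k Q t xi) <= A * weighted_fourier (j%:R + n%:R / 2 - 1) xi.
Proof.
move=> kj mn [_ hQ] A0 hM; have r0 := dotR3_ge0 xi.
have p1 : 1 <= 1 + dotR3 xi xi by rewrite lerDl.
have p0 : 0 < 1 + dotR3 xi xi by rewrite ltr_pwDl.
rewrite normc_evol_symbol /weighted_fourier !mulrA ler_wpM2r ?normc_ge0//.
rewrite -(ler_pM2l p0) mulrA mulrCA weight_powR (mulrA A).
have s1 : 1 <= Num.sqrt (1 + dotR3 xi xi) by rewrite -[leLHS]sqrtr1 ler_sqrt // (ltW p0).
apply: ler_pM => //; rewrite ?mulr_ge0 ?normc_ge0 ?(ltW p0)//.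
  by apply: (le_trans hM); rewrite ler_wpM2l// ler_weXn2l.
apply: (le_trans (hQ xi)); apply: (@le_trans _ _ (Num.sqrt (1 + dotR3 xi xi) ^+ m)).
  by apply: lerXn2r; rewrite ?nnegrE ?sqrtr_ge0// sqrt_sqnorm_le.
by rewrite ler_weXn2l.
Qed.

Section Derivatives.
Variables (j n : nat).
(** Integrability at the top order serves every intermediate derivative, since 1 + rho >= 1 makes
    the weights of lower order smaller. It will follow from the finite H^s norm. *)
Hypothesis iG : mu.-integrable setT (EFin \o weighted_fourier (j%:R + n%:R / 2 - 1)).

Lemma cintegrable_evol_symbol k m Q t : (k <= j)%N -> (m <= n)%N ->
  symbol_of_order m Q -> -1 <= t -> cintegrable (evol_symbol k Q t).
Proof.
move=> kj mn hQ t1; split; first exact: cmeasurable_evol_symbol hQ.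
have [A [kap [A0 kap0 h1 _ _]]] := dmult_bounds k sigma_gt0.
apply: integrable_dom (integrableZl_EFin A iG) _.
  by apply: measurable_normc; exact: cmeasurable_evol_symbol hQ.
move=> xi; rewrite ger0_norm ?normc_ge0//; apply: normc_evol_symbol_le hQ _ _ => //.
  exact: ltW.
by apply: h1 => //; exact: dotR3_ge0.
Qed.

Lemma iter_dx (e : R3 R) k m Q : (forall xi, `|dotR3 e xi| <= Num.sqrt (dotR3 xi xi)) ->
  (k + m <= n)%N -> symbol_of_order m Q ->
  iter_deriv (is_dx e) k (evol j Q) (evol j (monom e k Q)).
Proof.
move=> he + hQ; elim: k => [|k ih] km /=.
  by congr evol; apply/funext => xi; rewrite /monom expr0 mul1r.
exists (evol j (monom e k Q)); first by apply: ih; exact: ltnW.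
move=> x t t0.
have t1 : -1 <= t by rewrite (le_trans _ t0)// lerN10.
have E : evol_symbol j (monom e k.+1 Q) t =
    (fun xi => 'i%C * ((dotR3 e xi)%:C)%C * evol_symbol j (monom e k Q) t xi).
  by apply/funext => xi; rewrite /evol_symbol /monom exprS; ring.
rewrite /evol E; apply: is_derive_inv_fourier.
  apply: (cintegrable_evol_symbol (leqnn j) (ltnW km)) t1.
  exact: symbol_of_order_monom.
rewrite -E; apply: (cintegrable_evol_symbol (leqnn j) km) t1.
exact: symbol_of_order_monom.
Qed.

(** Differentiation under the integral takes place on ]-1, t + 1[, which contains t = 0 in its
    interior. The two-sided limit is then restricted to the times t + h >= 0. *)
Lemma is_dt_evol k : (k < j)%N -> is_dt (evol k (fun=> 1)) (evol k.+1 (fun=> 1)).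
Proof.
move=> kj x t t0.
have [A [kap [A0 kap0 h1 _ _]]] := dmult_bounds k.+1 sigma_gt0.
pose G xi := A * weighted_fourier (j%:R + n%:R / 2 - 1) xi.
have iAG : mu.-integrable setT (EFin \o G) := integrableZl_EFin A iG.
have iGG : mu.-integrable setT (EFin \o (fun xi => G xi + G xi)) := integrableD measurableT iAG iAG.
have G_ub r xi : -1 < r < t + 1 -> normc (evol_symbol k.+1 (fun=> 1) r xi) <= G xi.
  move=> /andP[r1 _]; apply: (normc_evol_symbol_le kj (leq0n n) symbol_of_order1 (ltW A0)).
  by apply: h1; [exact: dotR3_ge0|exact: ltW].
have ii r : -1 < r < t + 1 -> cintegrable (evol_symbol k (fun=> 1) r).
  by move=> /andP[r1 _]; apply: (cintegrable_evol_symbol (ltnW kj) (leq0n n) symbol_of_order1); exact: ltW.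
have tuv : -1 < t < t + 1 by rewrite ltrDl ltr01 andbT (lt_le_trans _ t0)// ltrN10.
pose F xi := 1 * fourier f xi.
have SE l r xi : evol_symbol l (fun=> 1) r xi =
    Complex (dmult sigma (dotR3 xi xi) l r * Re (F xi)) (dmult sigma (dotR3 xi xi) l r * Im (F xi)).
  rewrite /evol_symbol -/(F xi); case: (F xi) => p q.
  by apply/eqP; rewrite eq_complex /=; apply/andP; split; apply/eqP; ring.
have dM l r xi := is_derive_dmult sigma (dotR3 xi xi) l r.
split; rewrite /is_derive_ge0; apply: cvg_within_filter.
  pose g r xi := cos (dotR3 x xi) * Re (evol_symbol k (fun=> 1) r xi) -
     sin (dotR3 x xi) * Im (evol_symbol k (fun=> 1) r xi).
  pose dg r xi := cos (dotR3 x xi) * Re (evol_symbol k.+1 (fun=> 1) r xi) -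
     sin (dotR3 x xi) * Im (evol_symbol k.+1 (fun=> 1) r xi).
  have -> : (fun h => h^-1 * (Re (evol k (fun=> 1) x (t + h)) - Re (evol k (fun=> 1) x t))) =
      (fun h : R => h^-1 *: (\int[mu]_xi g (h + t) xi - \int[mu]_xi g t xi)).
    by apply/funext => h; rewrite /evol !inv_fourierE (addrC t h).
  have -> : Re (evol k.+1 (fun=> 1) x t) = \int[mu]_xi dg t xi by exact: (congr1 Re (inv_fourierE _ x)).
  apply: (@cvg_diff_quotient_integral _ g dg (fun xi => G xi + G xi) (-1) (t + 1) t tuv _ _ iGG _).
  - by move=> r /ii ir; exact: (integrable_rot x (cintegrable_Re ir) (cintegrable_Im ir)).1.
  - move=> r xi _; rewrite /g /dg; under eq_fun do rewrite !SE /=.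
    by rewrite !SE /=; apply: is_derive_eq; rewrite /GRing.scale /=; ring.
  - move=> r xi hr; rewrite (le_trans (normr_rot_le _ _ _))// lerD//.
      exact: le_trans (normr_Re_le _) (G_ub r xi hr).
    exact: le_trans (normr_Im_le _) (G_ub r xi hr).
pose g r xi := cos (dotR3 x xi) * Im (evol_symbol k (fun=> 1) r xi) +
   sin (dotR3 x xi) * Re (evol_symbol k (fun=> 1) r xi).
pose dg r xi := cos (dotR3 x xi) * Im (evol_symbol k.+1 (fun=> 1) r xi) +
   sin (dotR3 x xi) * Re (evol_symbol k.+1 (fun=> 1) r xi).
have -> : (fun h => h^-1 * (Im (evol k (fun=> 1) x (t + h)) - Im (evol k (fun=> 1) x t))) =
    (fun h : R => h^-1 *: (\int[mu]_xi g (h + t) xi - \int[mu]_xi g t xi)).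
  by apply/funext => h; rewrite /evol !inv_fourierE (addrC t h).
have -> : Im (evol k.+1 (fun=> 1) x t) = \int[mu]_xi dg t xi by exact: (congr1 Im (inv_fourierE _ x)).
apply: (@cvg_diff_quotient_integral _ g dg (fun xi => G xi + G xi) (-1) (t + 1) t tuv _ _ iGG _).
- by move=> r /ii ir; exact: (integrable_rot x (cintegrable_Im ir) (cintegrable_Re ir)).2.
- move=> r xi _; rewrite /g /dg; under eq_fun do rewrite !SE /=.
  by rewrite !SE /=; apply: is_derive_eq; rewrite /GRing.scale /=; ring.
- move=> r xi hr; rewrite (le_trans (normr_rotD_le _ _ _))// lerD//.
    exact: le_trans (normr_Im_le _) (G_ub r xi hr).
  exact: le_trans (normr_Re_le _) (G_ub r xi hr).
Qed.

Lemma iter_dt k : (k <= j)%N ->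
  iter_deriv (@is_dt R) k (evol 0 (fun=> 1)) (evol k (fun=> 1)).
Proof.
elim: k => [//|k ih] kj; exists (evol k (fun=> 1)); first by apply: ih; exact: ltnW.
exact: is_dt_evol.
Qed.

End Derivatives.
End Symbols.

(** * Decay estimate *)

Section DecayEstimate.
Variable R : realType.
Local Notation mu := (leb3 R).
Local Notation normc := (@ComplexField.Normc.normc R).

Lemma normLp1E (f : R3 R -> R[i]) : normLp 1 f = (\int[mu]_x (normc (f x))%:E)%E.
Proof.
rewrite /normLp Lnorm1; apply: eq_integral => x _ /=.
by rewrite ger0_norm ?normc_ge0.
Qed.

Lemma inLp1_cintegrable (f : R3 R -> R[i]) : inLp 1 f -> cintegrable f.
Proof.
move=> [mf]; rewrite normLp1E => foo; split => //; apply: ge0_integrable => //.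
  exact: measurable_normc.
by move=> x; exact: normc_ge0.
Qed.

Lemma normLp1_EFin (f : R3 R -> R[i]) : cintegrable f ->
  normLp 1 f = (\int[mu]_x normc (f x))%:E.
Proof.
move=> [_ jn]; rewrite normLp1E /Rintegral fineK//; exact: (integrable_fin_num _ jn).
Qed.

(** Cauchy-Schwarz for (1 + rho)^q = (1 + rho)^(q - s/2) (1 + rho)^(s/2). With q = j + n / 2 - 1 the
    condition 2 q - s < -3/2 reads s > 2 j + n - 1/2. D is the L^2 norm of the first factor, hence
    independent of f. *)
Lemma integral_weighted_fourier_le (s q : R) : 2 * q - s < - (3 / 2) ->
  exists2 D, 0 <= D & forall f : R3 R -> R[i], cintegrable f ->
    (\int[mu]_xi (weighted_fourier f q xi)%:E <= D%:E * normHs s f)%E.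
Proof.
move=> qs; pose w (xi : R3 R) := (1 + dotR3 xi xi) `^ (q - s / 2).
have mw : measurable_fun setT w by exact: measurable_japanese.
have N2 : (Lnorm mu 2%:E (EFin \o w) < +oo)%E.
  rewrite unlock /Lnorm.
  apply: poweR_lty.
  apply: le_lt_trans (integral3_japanese_lty qs).
  rewrite le_eqVlt; apply/orP; left; apply/eqP; apply: eq_integral => xi _ /=.
  rewrite ger0_norm ?powR_ge0// -powRrM; congr (_ `^ _)%:E.
  by field.
have N20 := Lnorm_ge0 mu 2%:E (EFin \o w).
exists (fine (Lnorm mu 2%:E (EFin \o w))); first exact: fine_ge0.
move=> f jf; rewrite fineK ?ge0_fin_numE//.
pose v xi := (1 + dotR3 xi xi) `^ (s / 2) * normc (fourier f xi).
have mv : measurable_fun setT v by exact: measurable_weighted_fourier.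
have -> : normHs s f = Lnorm mu 2%:E (EFin \o v).
  rewrite /normHs /normLp; congr Lnorm; apply/funext => xi.
  by rewrite ComplexField.Normc.normcM normc_real ger0_norm ?powR_ge0.
have half : 2^-1 + 2^-1 = 1 :> R by field.
have := hoelder mu mw mv (ltr0Sn _ 1) (ltr0Sn _ 1) half.
rewrite Lnorm1; apply: le_trans.
rewrite le_eqVlt; apply/orP; left; apply/eqP; apply: eq_integral => xi _ /=.
have p0 : 0 < 1 + dotR3 xi xi by rewrite ltr_pwDl// dotR3_ge0.
rewrite ger0_norm ?mulr_ge0 ?powR_ge0 ?normc_ge0// /w /v /weighted_fourier mulrA -powRD.
  by rewrite subrK.
by apply/implyP => _; rewrite gt_eqF.
Qed.

Lemma evol_bound (sigma : R) (j n : nat) (s : R) : 0 < sigma ->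
  (2 * j)%:R + n%:R - 1 / 2 < s ->
  exists C c, [/\ 0 < C, 0 < c & forall (f : R3 R -> R[i]) Q, inL1Hs s f -> symbol_of_order n Q ->
    forall x t, 0 <= t ->
    ((normc (evol sigma f j Q x t))%:E <=
      C%:E * (((1 + t) `^ (- ((3 + n)%:R / 4)))%:E * normLp 1 f
              + (expR (- (c * t)))%:E * normHs s f))%E].
Proof.
move=> s0 hs.
have [A [k [A0 k0 hA1 hA2 hA3]]] := dmult_bounds j s0.
have [Cl Cl0 hlow] := low_frequency_bound n k0.
pose q : R := j%:R + n%:R / 2 - 1.
have [D D0 hD] : exists2 D, 0 <= D & forall f : R3 R -> R[i], cintegrable f ->
    (\int[mu]_xi (weighted_fourier f q xi)%:E <= D%:E * normHs s f)%E.
  by apply: integral_weighted_fourier_le; rewrite /q; move: hs; rewrite natrM; lra.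
pose c0 : R := (2 * pi) ^- 3; have c00 : 0 <= c0 by exact: inv_2pi3_ge0.
(* The outer 4 comes from inverting the transform, 4 c0 from the bound of [fourier f] by the L^1
   norm, Cl and D from the low and high frequencies; the summand 1 ensures positivity when D = 0. *)
exists (4 * A * (4 * c0 * Cl + D + 1)), k; split => //.
  by rewrite !mulr_gt0// ltr_wpDl// addr_ge0// !mulr_ge0// ltW.
move=> f Q [fL1 fHs] hQ x t t0.
have jf := inLp1_cintegrable fL1.
pose N := \int[mu]_x normc (f x).
have N0 : 0 <= N by apply: Rintegral_ge0 => y _; exact: normc_ge0.
have hN : normLp 1 f = N%:E by exact: normLp1_EFin.
have hH0 : (0 <= normHs s f)%E by exact: Lnorm_ge0.
have [H H0 hH] : exists2 H, 0 <= H & normHs s f = H%:E.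
  by exists (fine (normHs s f)); [exact: fine_ge0|rewrite fineK// ge0_fin_numE].
have iG : mu.-integrable setT (EFin \o weighted_fourier f q).
  apply: ge0_integrable; [exact: measurable_weighted_fourier|exact: weighted_fourier_ge0|].
  by apply: (le_lt_trans (hD f jf)); rewrite hH -EFinM ltry.
have t1 : -1 <= t by rewrite (le_trans _ t0)// lerN10.
have jS := cintegrable_evol_symbol s0 jf iG (leqnn j) (leqnn n) hQ t1.
apply: (le_trans (normc_inv_fourier_le x jS)).
have [g [mg g0 intg hg]] := hlow t t0.
have mG : measurable_fun setT (weighted_fourier f q) by exact: measurable_weighted_fourier.
have G0 := weighted_fourier_ge0 f q.
pose B := c0 * (4 * N); have B0 : 0 <= B by rewrite !mulr_ge0.
pose E := expR (- (k * t)); have E0 : 0 <= E by exact: expR_ge0.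
have AB0 : 0 <= A * B by exact: mulr_ge0 (ltW A0) B0.
have AE0 : 0 <= A * E by exact: mulr_ge0 (ltW A0) E0.
(* One of the two terms suffices on each side of rho = 1. Both being nonnegative everywhere, their
   sum is integrated over the whole space without cutting the domain. *)
have pw xi : normc (evol_symbol sigma f j Q t xi) <= A * B * g xi + A * E * weighted_fourier f q xi.
  have r0 := dotR3_ge0 xi.
  have [r1|r1] := leP (dotR3 xi xi) 1.
    apply: (@le_trans _ _ (A * B * g xi)); last by rewrite lerDl; exact: mulr_ge0 AE0 (G0 xi).
    rewrite normc_evol_symbol.
    have h1 := hA2 _ _ r0 r1 t0; have h2 := hg xi r1; have h3 := normc_fourier_le xi jf.
    have [_ /(_ xi) h4] := hQ.
    apply: (@le_trans _ _ (A * expR (- (k * dotR3 xi xi ^+ 2 * t)) * (Num.sqrt (dotR3 xi xi) ^+ n * B))).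
      apply: ler_pM => //; first by rewrite mulr_ge0 ?normc_ge0.
      by apply: ler_pM; rewrite ?normc_ge0.
    rewrite (_ : _ * _ = A * B * (Num.sqrt (dotR3 xi xi) ^+ n * expR (- (k * dotR3 xi xi ^+ 2 * t)))); last by ring.
    by rewrite ler_wpM2l.
  apply: (@le_trans _ _ (A * E * weighted_fourier f q xi)); last by rewrite lerDr; exact: mulr_ge0 AB0 (g0 xi).
  apply: (normc_evol_symbol_le f (leqnn j) (leqnn n) hQ) => //.
  by rewrite mulrAC; apply: hA3 => //; exact: ltW.
apply: (@le_trans _ _ (4%:E * ((A * B)%:E * (Cl * (1 + t) `^ (- ((3 + n)%:R / 4)))%:E +
    (A * E)%:E * (D%:E * normHs s f)))%E).
  apply: lee_wpmul2l => //.
  apply: (@le_trans _ _ (\int[mu]_xi ((A * B)%:E * (g xi)%:E + (A * E)%:E * (weighted_fourier f q xi)%:E))%E).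
    apply: ge0_le_integral => //.
    - by move=> xi _; rewrite lee_fin normc_ge0.
    - by apply/measurable_EFinP; apply: measurable_normc; case: jS.
    - by apply/measurable_EFinP; apply: measurable_funD; exact: measurable_funM.
    by move=> xi _; rewrite -!EFinM -EFinD lee_fin.
  rewrite ge0_integralD//; last 4 first.
  - by move=> xi _; rewrite -EFinM lee_fin mulr_ge0.
  - by apply/measurable_EFinP; exact: measurable_funM.
  - by move=> xi _; rewrite -EFinM lee_fin mulr_ge0.
  - by apply/measurable_EFinP; exact: measurable_funM.
  rewrite ge0_integralZl//; last 2 first.
  - exact/measurable_EFinP.
  - by move=> xi _; rewrite lee_fin.
  rewrite ge0_integralZl//; last 2 first.
  - exact/measurable_EFinP.
  - by move=> xi _; rewrite lee_fin.
  rewrite intg leeD2l//; apply: lee_wpmul2l; first by rewrite lee_fin.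
  exact: hD.
rewrite hN hH -!EFinM lee_fin -/E.
have p0 : 0 <= (1 + t) `^ (- ((3 + n)%:R / 4)) by exact: powR_ge0.
move: ((1 + t) `^ _) p0 => p p0; rewrite /B.
have A1 := ltW A0; have Cl1 := ltW Cl0.
have h1 := mulr_ge0 (mulr_ge0 A1 p0) N0; have h2 := mulr_ge0 (mulr_ge0 A1 E0) H0.
have h3 := mulr_ge0 D0 h1; have h4 := mulr_ge0 (mulr_ge0 c00 Cl1) h2.
by lra.
Qed.

Lemma Lnorm2_fourier_le : exists2 K : R, 0 <= K & forall f : R3 R -> R[i], cintegrable f ->
  (normHs 0 f <= K%:E * normLp 2 f)%E.
Proof.
pose c1 : R := 2 * (2 * pi) ^- 3.
have c10 : 0 <= c1 by rewrite mulr_ge0// inv_2pi3_ge0.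
exists (c1 `^ 2^-1); first exact: powR_ge0.
move=> f jf; have P := plancherel_le jf.
rewrite /normHs /normLp unlock /Lnorm.
have sq (g : R3 R -> R[i]) : (\int[mu]_x (`|(normc (g x))%:E| `^ 2) = \int[mu]_x (normc (g x) ^+ 2)%:E)%E.
  apply: eq_integral => x _ /=.
  by rewrite ger0_norm ?normc_ge0// powR_mulrn ?normc_ge0.
rewrite !sq -poweR_EFin -poweRM//; last by apply: integral_ge0 => x _; rewrite lee_fin sqr_ge0.
have -> : (\int[mu]_xi (normc ((((1 + dotR3 xi xi) `^ (0 / 2))%:C)%C * fourier f xi) ^+ 2)%:E =
    \int[mu]_xi (normc (fourier f xi) ^+ 2)%:E)%E.
  by apply: eq_integral => xi _; rewrite mul0r powRr0 mul1r.
apply: gt0_ler_poweR => //.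
- by rewrite in_itv/= leey andbT; apply: integral_ge0 => x _; rewrite lee_fin sqr_ge0.
- by rewrite in_itv/= leey andbT mule_ge0//; apply: integral_ge0 => x _; rewrite lee_fin sqr_ge0.
Qed.

(** The chain is (1 + t)^(3/4) <= 1 + t <= (1 + 1/c) (1 + c t) <= (1 + 1/c) e^(c t). *)
Lemma expRN_le_powR (c : R) : 0 < c -> exists2 K, 0 <= K & forall t, 0 <= t ->
  expR (- (c * t)) <= K * (1 + t) `^ (- (3 / 4)).
Proof.
move=> c0; have c1 : 0 < c^-1 by rewrite invr_gt0.
exists (1 + c^-1); first by rewrite addr_ge0// ltW.
move=> t t0; have T1 : 1 <= 1 + t by rewrite lerDl.
have T0 : 0 < 1 + t by rewrite ltr_pwDl.
rewrite expRN powRN ler_pdivlMr ?powR_gt0// mulrC ler_pdivrMr ?expR_gt0//.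
apply: (@le_trans _ _ (1 + t)).
  by rewrite -[leRHS]powRr1 ?(ltW T0)// ler_powR//; lra.
apply: (@le_trans _ _ ((1 + c^-1) * (1 + c * t))); last first.
  by rewrite ler_wpM2l ?expR_ge1Dx// addr_ge0// ltW.
rewrite (_ : (1 + c^-1) * _ = 1 + t + (c^-1 + c * t)); last by field; rewrite gt_eqF.
by rewrite lerDl addr_ge0 ?mulr_ge0 ?(ltW c1) ?(ltW c0).
Qed.

End DecayEstimate.

Unset Implicit Arguments.
Theorem theoremB1 (R : realType) (sigma : R) (sigma_gt0 : 0 < sigma) :
  (forall (j : nat) (alpha : nat * nat * nat) (s : R),
    (2 * j)%:R + (order_alpha alpha)%:R - 1 / 2 < s ->
    exists C c : R, [/\ 0 < C, 0 < c &
      forall f : R3 R -> R[i], inL1Hs s f ->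
      exists2 W : R3 R -> R -> R[i],
        is_mixed_deriv alpha j (solution sigma f) W &
        forall t : R, 0 <= t ->
          (sup_norm (fun x => W x t) <=
           C%:E * (((1 + t) `^ (- ((3 + order_alpha alpha)%:R / 4)))%:E
                     * normLp 1 f
                   + (expR (- (c * t)))%:E * normHs s f))%E]) /\
  (exists C : R, 0 < C /\
    forall f : R3 R -> R[i], inLp 1 f -> inLp 2 f ->
    forall t : R, 0 <= t ->
      (sup_norm (fun x => solution sigma f x t) <=
       C%:E * (((1 + t) `^ (- (3 / 4)))%:E * (normLp 1 f + normLp 2 f)))%E).
Proof.
have part1 : forall (j : nat) (alpha : nat * nat * nat) (s : R),
    (2 * j)%:R + (order_alpha alpha)%:R - 1 / 2 < s ->
    exists C c : R, [/\ 0 < C, 0 < c &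
      forall f : R3 R -> R[i], inL1Hs s f ->
      exists2 W : R3 R -> R -> R[i],
        is_mixed_deriv alpha j (solution sigma f) W &
        forall t : R, 0 <= t ->
          (sup_norm (fun x => W x t) <=
           C%:E * (((1 + t) `^ (- ((3 + order_alpha alpha)%:R / 4)))%:E
                     * normLp 1 f
                   + (expR (- (c * t)))%:E * normHs s f))%E].
  move=> j alpha s hs; have [C [c [C0 c0 hC]]] := evol_bound sigma_gt0 hs.
  exists C, c; split => // f hf; have [fL1 fHs] := hf.
  have jf := inLp1_cintegrable fL1.
  pose e1 : R3 R := (1, 0, 0); pose e2 : R3 R := (0, 1, 0); pose e3 : R3 R := (0, 0, 1).
  have sq3 (x : R) (xi : R3 R) : x ^+ 2 <= dotR3 xi xi -> `|x| <= Num.sqrt (dotR3 xi xi).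
    by move=> h; rewrite -sqrtr_sqr ler_sqrt// dotR3_ge0.
  have he1 xi : `|dotR3 e1 xi| <= Num.sqrt (dotR3 xi xi).
    apply: sq3; rewrite /dotR3 /= !mul0r mul1r !addr0 -!expr2 -addrA lerDl.
    by rewrite addr_ge0 ?sqr_ge0.
  have he2 xi : `|dotR3 e2 xi| <= Num.sqrt (dotR3 xi xi).
    apply: sq3; rewrite /dotR3 /= !mul0r mul1r add0r !addr0 -!expr2 addrAC lerDr.
    by rewrite addr_ge0 ?sqr_ge0.
  have he3 xi : `|dotR3 e3 xi| <= Num.sqrt (dotR3 xi xi).
    apply: sq3; rewrite /dotR3 /= !mul0r mul1r !add0r -!expr2 lerDr.
    by rewrite addr_ge0 ?sqr_ge0.
  pose Q0 : R3 R -> R[i] := fun=> 1.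
  have h0 : symbol_of_order 0 Q0 := symbol_of_order1 R.
  (* Monomials are attached in the order x_3, x_2, x_1 imposed by [is_mixed_deriv]; the orders add
     up to |alpha|. *)
  pose Q3 := monom e3 alpha.2 Q0; have h3 := symbol_of_order_monom alpha.2 he3 h0.
  pose Q2 := monom e2 alpha.1.2 Q3; have h2 := symbol_of_order_monom alpha.1.2 he2 h3.
  pose Q1 := monom e1 alpha.1.1 Q2; have h1 := symbol_of_order_monom alpha.1.1 he1 h2.
  pose n := order_alpha alpha.
  have n1 : (alpha.1.1 + (alpha.1.2 + (alpha.2 + 0)) = n)%N by rewrite addn0 addnA.
  rewrite n1 in h1.
  have iG : (leb3 R).-integrable setT (EFin \o weighted_fourier f (j%:R + n%:R / 2 - 1)).
    have [D _ hD] : exists2 D, 0 <= D & forall f : R3 R -> R[i], cintegrable f ->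
        (\int[leb3 R]_xi (weighted_fourier f (j%:R + n%:R / 2 - 1) xi)%:E <= D%:E * normHs s f)%E.
      by apply: integral_weighted_fourier_le; move: hs; rewrite natrM -/n; lra.
    apply: ge0_integrable; [exact: measurable_weighted_fourier|exact: weighted_fourier_ge0|].
    apply: (le_lt_trans (hD f jf)).
    have : normHs s f \is a fin_num by rewrite ge0_fin_numE// Lnorm_ge0.
    by case: (normHs s f) => // r _; rewrite -EFinM ltry.
  exists (evol sigma f j Q1).
    exists (evol sigma f j Q0), (evol sigma f j Q3), (evol sigma f j Q2); split.
    - by rewrite solutionE; exact: iter_dt iG _ (leqnn j).
    - apply: (iter_dx sigma_gt0 jf iG he3 _ h0).
      by rewrite addn0 /n /order_alpha leq_addl.
    - apply: (iter_dx sigma_gt0 jf iG he2 _ h3).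
      by rewrite addn0 /n /order_alpha -addnA leq_addl.
    - apply: (iter_dx sigma_gt0 jf iG he1 _ h2).
      by rewrite n1.
  move=> t t0; apply: ub_ereal_sup => _ [x _ <-].
  exact: hC.
split => //.
(* For j = |alpha| = 0 the threshold is -1/2, so s = 0 is admissible. *)
have h00 : (2 * 0)%:R + (order_alpha (0, 0, 0)%N)%:R - 1 / 2 < 0 :> R.
  by rewrite muln0 /order_alpha /=; lra.
have [C [c [C0 c0 hC]]] := part1 0%N (0, 0, 0)%N 0 h00.
have [K K0 hK] := Lnorm2_fourier_le R; have [L L0 hL] := expRN_le_powR c0.
(* L turns the exponential into (1 + t)^(-3/4) and K turns the H^0 norm into the L^2 norm. *)
exists (C * (1 + L * K)); split.
  by rewrite mulr_gt0// ltr_wpDr// mulr_ge0.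
move=> f f1 f2 t t0; have jf := inLp1_cintegrable f1.
have fH := hK f jf; have [_ f2oo] := f2.
have [b b0 fb] : exists2 b, 0 <= b & normLp 2 f = b%:E.
  exists (fine (normLp 2 f)); first by apply: fine_ge0; exact: Lnorm_ge0.
  by rewrite fineK// ge0_fin_numE// Lnorm_ge0.
have fs : inL1Hs 0 f.
  by split => //; apply: (le_lt_trans fH); rewrite fb -EFinM ltry.
(* With no derivatives, each [iter_deriv] is an equality, so W is the solution itself. *)
have [W [V0 [V3 [V2 []]]] /=] := hC f fs.
move=> E0 E3 E2 E1 hW; rewrite E1 E2 E3 E0 in hW.
apply: (le_trans (hW t t0)).
rewrite /order_alpha /= addn0.
have [a a0 fa] : exists2 a, 0 <= a & normLp 1 f = a%:E.
  exists (fine (normLp 1 f)); first by apply: fine_ge0; exact: Lnorm_ge0.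
  by rewrite fineK// ge0_fin_numE ?Lnorm_ge0//; case: f1.
have [d d0 fd] : exists2 d, 0 <= d & normHs 0 f = d%:E.
  exists (fine (normHs 0 f)); first by apply: fine_ge0; exact: Lnorm_ge0.
  rewrite fineK// ge0_fin_numE ?Lnorm_ge0//.
  by apply: (le_lt_trans fH); rewrite fb -EFinM ltry.
move: fH; rewrite fa fb fd -!EFinM !lee_fin => dKb.
have hLt := hL t t0; have p0 : 0 <= (1 + t) `^ (- (3 / 4)) by exact: powR_ge0.
rewrite -mulrA ler_pM2l//.
have h1 : expR (- (c * t)) * d <= L * (1 + t) `^ (- (3 / 4)) * (K * b).
  by apply: ler_pM => //; exact: expR_ge0.
move: ((1 + t) `^ (- (3 / 4))) p0 h1 => p p0 h1.
have := mulr_ge0 p0 b0; have := mulr_ge0 (mulr_ge0 L0 K0) (mulr_ge0 p0 a0); lra.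
Qed.
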